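(* Consider the system $\dot{\mathbf y}=\Phi(\mathbf y,u)$ on $\mathbb{R}^{N_{\rm a}}$, $$\dot y_i=\Phi_i(\mathbf y,u) = -d y_i+\hat{\mathbf p}_i^T S\Big(u\big(\alpha y_i\hat{\mathbf p}_i+\gamma\sum_{k\ne i}(A_{\rm a})_{ik}y_k\hat{\mathbf p}_k\big)\Big)+b_{ei},\qquad i=1,\dots,N_{\rm a},$$ and let $u^*=\frac{d}{\alpha+\lambda\gamma}$, where $\lambda$ is a simple real eigenvalue of the transformed adjacency matrix $A_{\rm a}'$, $[A_{\rm a}']_{ik}=(\hat{\mathbf p}_i^T\hat{\mathbf p}_k)[A_{\rm a}]_{ik}$, with eigenvector $\mathbf v=(v_1,\dots,v_{N_{\rm a}})^T$. Assume $\alpha+\lambda\gamma\neq 0$. Let $h(x,u)$ be the Lyapunov–Schmidt reduction of $\Phi(\mathbf y,u)=0$ at $(\mathbf y,u)=(\mathbf 0,u^* )$. (1) For zero effective bias $\mathbf b_e=(b_{e1},\dots,b_{eN_{\rm a}})^T=\mathbf 0$, $h(x,u)$ has a symmetric pitchfork singularity at $(x,u)=(0,u^* )$. For $u>u^*$ and sufficiently small $|u-u^*|$, two branches of equilibria branch off from $\mathbf y=\mathbf 0$ in a pitchfork bifurcation along a manifold tangent at $\mathbf y=\mathbf 0$ to $\operatorname{span}\{\mathbf v\}$. When $u^*>0$ (respectively $u^*<0$), the pitchfork bifurcation happens supercritically (respectively subcritically) with respect to $u$. (2) For $\mathbf b_e\neq\mathbf 0$ the bifurcation problem is an $N_{\rm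 a}$-parameter unfolding of the symmetric pitchfork, with $\frac{\partial h}{\partial b_{ei}}=v_i$.
   Context: $N_{\rm a}$ is the number of agents and $N_{\rm o}$ the number of options. $\hat{\mathbf p}_i=\mathbf p_i/\|\mathbf p_i\|\in\mathbb{R}^{N_{\rm o}}$ is the unit vector along agent $i$'s nonzero constraint vector $\mathbf p_i$. $A_{\rm a}\in\mathbb{R}^{N_{\rm a}\times N_{\rm a}}$ is symmetric, irreducible, with entries in $\{0,1\}$ and zero diagonal. $S:\mathbb{R}\to\mathbb{R}$ (applied entrywise to vectors) is an odd sigmoidal saturating function with $S(0)=0$, $S'(0)=1$, $\operatorname{sign}(S''(z))=-\operatorname{sign}(z)$. Parameters $d>0$, $\gamma>0$, $\alpha>0$; $b_{ei}\in\mathbb{R}$; $u$ is the real bifurcation parameter. For $\mathbf b_e=\mathbf 0$, the Jacobian of $\Phi$ at $\mathbf y=\mathbf 0$ is $(u\alpha-d)I+u\gamma A_{\rm a}'$, which is symmetric. Lyapunov–Schmidt reduction: the component of $\Phi=0$ orthogonal to $\operatorname{span}\{\mathbf v\}$ (the kernel of the Jacobian at $(\mathbf 0,u^* )$) is solved, by the implicit function theorem, for the component $W$ of $\mathbf y$ orthogonal to $\mathbf v$ as a function of $x$ (where $\mathbf y=x\mathbf v+W$) and of the parameters; $h$ is the scalar function obtained by projecting onto $\mathbf v$: $h(x,u)=\mathbf v^T\Phi(x\mathbf v+W,u)$. It depends also on $\mathbf b_e$, regarded as unfolding parameters near $\mathbf 0$. A symmetric pitchfork singularity is one equivalent, in the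 sense of singularity theory for bifurcation problems, to $q_1x\pm x^3=0$ at $x=0$, with $q_1$ the bifurcation parameter. The universal unfolding of the pitchfork is $q_1x\pm x^3+q_2+q_3x^2=0$, with unfolding parameters $q_2,q_3$.
   Formalization: Adds S'''(0)≠0 and a nonzero cubic coefficient C of the reduction (otherwise no pitchfork); branches for u>u* and super/subcriticality (via stability in x'=h) are claimed for C>0, branches for u<u* when C<0. S is taken smooth; ∂h/∂b_ei=v_i holds at the bifurcation point. *)

(* Defs.v *)
(* MathComp / MathComp-Analysis *)
From HB Require Import structures.
From mathcomp Require Import all_boot all_order all_algebra.
From mathcomp Require Import all_classical all_reals all_analysis.

Set Implicit Arguments.
Unset Strict Implicit.
Unset Printing Implicit Defensive.

Import Order.TTheory GRing.Theory Num.Theory.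
Import numFieldNormedType.Exports.

Local Open Scope classical_set_scope.
Local Open Scope ring_scope.

Section Smoothness.
Context {R : realType} {V W : normedModType R}.

(* All iterated directional derivatives up to order k exist and are continuous
   on A.  For A open in a finite-dimensional V (the only use made of it) this is
   the usual class C^k. *)
Fixpoint class_C (k : nat) (f : V -> W) (A : set V) : Prop :=
  (forall x, A x -> {for x, continuous f}) /\
  if k is k'.+1 then
    forall v : V, (forall x, A x -> derivable f x v) /\ class_C k' ('D_v f) A
  else True.

(* f is of class C^oo on a neighbourhood of a. *)
Definition smooth_near (a : V) (f : V -> W) : Prop :=
  exists A : set V, open_nbhs a A /\ forall k, class_C k f A.

End Smoothness.

Section Euclidean.
Context {R : realType}.

(* The library norm on 'cV[R]_n is the sup norm (it only serves for the
   topology); lengths and angles are taken with respect to dotv. *)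
Definition dotv n (x y : 'cV[R]_n) : R := \sum_i x i 0 * y i 0.

Definition unitv n (x : 'cV[R]_n) : 'cV[R]_n := (Num.sqrt (dotv x x))^-1 *: x.

(* Orthogonal projection onto the complement of the line spanned by v. *)
Definition proj_perp n (v y : 'cV[R]_n) : 'cV[R]_n :=
  y - (dotv v y / dotv v v) *: v.

End Euclidean.

Section Model.
Context {R : realType} {Na No : nat}.

Definition irreducible_mx n (A : 'M[R]_n) : Prop :=
  forall I : {set 'I_n}, I != finset.set0 -> I != [set: 'I_n]%SET ->
    exists i k, [/\ i \in I, k \notin I & A i k != 0].

Definition sigmoid (S : R -> R) : Prop :=
  [/\ forall n z, derivable (S^`(n)%classic) z 1,
      [/\ forall z, S (- z) = - S z,
          {homo S : x y / x < y}
        & exists M, forall z, `|S z| <= M],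
      S 0 = 0 /\ S^`()%classic 0 = 1
    & forall z, Num.sg (S^`(2)%classic z) = - Num.sg z].

Variables (p : 'I_Na -> 'cV[R]_No) (Aa : 'M[R]_Na).

Definition transformed_adj : 'M[R]_Na :=
  \matrix_(i, k) (dotv (unitv (p i)) (unitv (p k)) * Aa i k).

Definition net_input (alpha gamma : R) (y : 'cV[R]_Na) (i : 'I_Na) :
    'cV[R]_No :=
  (alpha * y i 0) *: unitv (p i) +
  gamma *: \sum_(k | k != i) (Aa i k * y k 0) *: unitv (p k).

Definition vfield (S : R -> R) (d alpha gamma : R)
    (y : 'cV[R]_Na) (u : R) (b : 'cV[R]_Na) : 'cV[R]_Na :=
  \col_i (- d * y i 0
          + dotv (unitv (p i)) (map_mx S (u *: net_input alpha gamma y i))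
          + b i 0).

(* The third derivative of v^T Phi at y = 0 in the direction (v, v, v), for
   b = 0, is S'''(0) * u^3 * cubic_coef. *)
Definition cubic_coef (alpha gamma : R) (v : 'cV[R]_Na) : R :=
  \sum_i v i 0 * dotv (unitv (p i))
    (map_mx (fun z => z ^+ 3) (net_input alpha gamma v i)).

End Model.

Section LyapunovSchmidt.
Context {R : realType} {n : nat}.
Variables (F : 'cV[R]_n -> R -> 'cV[R]_n -> 'cV[R]_n) (v : 'cV[R]_n) (u0 : R).

(* W (x, u, b) is the germ at (0, u0, 0) of the solution w, orthogonal to v and
   close to 0, of the component of F (x v + w, u, b) = 0 orthogonal to v. *)
Definition LS_solution (W : R * R * 'cV[R]_n -> 'cV[R]_n) : Prop :=
  [/\ smooth_near ((0, u0, 0) : R * R * 'cV[R]_n) W,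
      W (0, u0, 0) = 0,
      \forall q \near ((0, u0, 0) : R * R * 'cV[R]_n), dotv v (W q) = 0
    & \forall z \near (((0, u0, 0), 0) : (R * R * 'cV[R]_n) * 'cV[R]_n),
        dotv v z.2 = 0 ->
        (proj_perp v (F (z.1.1.1 *: v + z.2) z.1.1.2 z.1.2) = 0
         <-> z.2 = W z.1)].

Definition LS_reduction (W : R * R * 'cV[R]_n -> 'cV[R]_n)
    (x u : R) (b : 'cV[R]_n) : R :=
  dotv v (F (x *: v + W (x, u, b)) u b).

End LyapunovSchmidt.

Section Bifurcation.
Context {R : realType}.
Implicit Types g f : R -> R -> R.

(* Golubitsky-Schaeffer equivalence of the germ of g at (x0, u0) with the germ
   of f at (0, 0); the second variable is the bifurcation parameter. *)
Definition bif_equiv g (x0 u0 : R) f : Prop :=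
  exists (T X : R * R -> R) (L : R -> R),
    [/\ [/\ smooth_near ((0, 0) : R * R) T,
            smooth_near ((0, 0) : R * R) X
          & smooth_near (0 : R) L],
        X (0, 0) = x0 /\ L 0 = u0,
        [/\ 0 < T (0, 0), 0 < 'D_((1, 0) : R * R) X (0, 0)
          & 0 < L^`()%classic 0]
      & \forall z \near ((0, 0) : R * R),
          T z * g (X z) (L z.2) = f z.1 z.2].

(* Since T > 0 in bif_equiv, the overall sign s of the bifurcation problem
   q x + e x^3 = 0 has to be allowed for explicitly. *)
Definition symmetric_pitchfork g (x0 u0 : R) : Prop :=
  exists s e : R, [/\ s = 1 \/ s = -1, e = 1 \/ e = -1
    & bif_equiv g x0 u0 (fun x q => s * (q * x + e * x ^+ 3))].

Definition is_unfolding k g (x0 u0 : R) (G : R -> R -> 'cV[R]_k -> R) : Prop :=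
  smooth_near ((x0, u0, 0) : R * R * 'cV[R]_k)
    (fun z => G z.1.1 z.1.2 z.2) /\
  \forall z \near ((x0, u0) : R * R), G z.1 z.2 0 = g z.1 z.2.

(* For x' = g x u with trivial equilibrium x = 0: near (0, u0), the nontrivial
   equilibria are stable and occur where the trivial one is unstable. *)
Definition supercritical g (u0 : R) : Prop :=
  \forall z \near ((0, u0) : R * R), z.1 != 0 -> g z.1 z.2 = 0 ->
    (fun x => g x z.2)^`()%classic z.1 < 0 /\
    0 < (fun x => g x z.2)^`()%classic 0.

Definition subcritical g (u0 : R) : Prop :=
  \forall z \near ((0, u0) : R * R), z.1 != 0 -> g z.1 z.2 = 0 ->
    0 < (fun x => g x z.2)^`()%classic z.1 /\
    (fun x => g x z.2)^`()%classic 0 < 0.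

(* Two branches of equilibria of y' = F y u bifurcate from y = 0 at u0 towards
   u > u0 if s = 1, towards u < u0 if s = -1.  They lie on the curve
   x |-> x v + w x, which is tangent to v at the origin. *)
Definition pitchfork_branches n (F : 'cV[R]_n -> R -> 'cV[R]_n)
    (v : 'cV[R]_n) (u0 s : R) : Prop :=
  exists (w : R -> 'cV[R]_n) (xp xm : R -> R) (N : set 'cV[R]_n) (r : R),
    let c x := x *: v + w x in
    [/\ 0 < r /\ nbhs (0 : 'cV[R]_n) N,
        [/\ smooth_near (0 : R) w, w 0 = 0, w^`()%classic 0 = 0
          & forall x, dotv v (w x) = 0],
        [/\ forall t, 0 < t < r ->
              {for t, continuous xp} /\ {for t, continuous xm},
            xp t @[t --> 0^'+] --> (0 : R)
          & xm t @[t --> 0^'+] --> (0 : R)],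
        forall t, 0 < t < r -> xm t < 0 < xp t /\
          [set y | N y /\ F y (u0 + s * t) = 0]
          = [set 0; c (xp t); c (xm t)]
      & forall t, 0 <= t < r ->
          [set y | N y /\ F y (u0 - s * t) = 0] = [set 0]].

End Bifurcation.

(* Main.v *)
Require Import Defs.
From HB Require Import structures.
From mathcomp Require Import all_boot all_order all_algebra.
From mathcomp Require Import all_classical all_reals all_analysis.
From mathcomp Require Import ring lra.

Set Implicit Arguments.
Unset Strict Implicit.
Unset Printing Implicit Defensive.

Import Order.TTheory GRing.Theory Num.Theory.
Import numFieldNormedType.Exports.

Local Open Scope classical_set_scope.
Local Open Scope ring_scope.

(** The idea of the proof is that the nonlinearity is cubic in a very strong
    sense, which makes the whole reduction explicit.

    Since [S 0 = 0], [S' 0 = 1] and [S'' 0 = 0], division by the variable gives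
    [S z = z + z ^ 3 * r z] with [r] smooth and [r 0 = S''' 0 / 6 < 0]
    ([sigmoid_cubic]).  The vector field is therefore
    [lin_field u y + N u 1 y + b], where [lin_field u] is the symmetric
    linearization and [N u x z] is a smooth family with
    [N u 1 (x z) = x ^ 3 N u x z].  The eigenvector [v] satisfies
    [lin_field u v = kappa (u - u0) v] for every [u], and simplicity of the
    eigenvalue means that [lin_field u0] is injective on the complement of [v]
    ([simple_eigenvector], [LS_operator_inj]).

    Existence of the Lyapunov-Schmidt solution is the implicit function theorem
    ([LS_germ]), and any two solutions agree as germs
    ([LS_solution_smooth]).  For zero bias the
    substitution [W = x ^ 3 omega] divides the reduced system by [x ^ 3] and
    leaves an equation that the implicit function theorem solves for a smooth
    [omega (x, u)] ([scaled_germ]).  As [lin_field u] is symmetric, projecting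
    on [v] yields
    [h (x, u, 0) = x (a (u - u0) + x ^ 2 m (x, u))], with [a = kappa |v| ^ 2],
    [m] smooth and [m (0, u0) = u0 ^ 3 (r 0) C] ([LS_reduction_cubic]).

    The rest is about this scalar equation.  Rescaling the state by a positive
    function [rho] with [rho ^ 2 m = e a] brings it to the pitchfork
    ([cubic_rescaling], [cubic_normal_form]); in that coordinate the branches
    are square roots of the parameter ([cubic_branches]), and
    differentiating [x (a (u - u0) + x ^ 2 m)] at a zero gives the stability
    ([cubic_stability]).  Solving the equation for [u] instead
    ([cubic_parameter]) exhibits the curve on which the equilibria lie
    ([LS_pitchfork_branches]).  The bias enters through [dotv v b] and through
    [W], but the latter contributes nothing to first order, because [lin_field]
    preserves the complement of [v] and [N] is cubic
    ([LS_reduction_derive_bias]).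

    The analytic part uses its own notion of smoothness, [frechet_C], built from
    Frechet differentials; it is stable under composition and implies the class
    defined by iterated directional derivatives ([frechet_C_class_C]).  The
    implicit function theorem is proved for one unknown by monotonicity, and for
    several unknowns by eliminating them one at a time. *)

(** * Smoothness through tangent maps *)

Section FrechetSmoothness.
Context {R : realType}.
Implicit Types U V W Z : normedModType R.

(** Differentiability by epsilon estimates, without Landau notations. *)
Lemma is_diff_remainder V W (f : V -> W) (x : V) (L : {linear V -> W}) :
  continuous L ->
  (forall e, 0 < e -> \forall y \near x,
     `|f y - f x - L (y - x)| <= e * `|y - x|) ->
  is_diff x f L.
Proof.
move=> Lc H.
have E : f \o shift x = cst (f x) + L +o_ 0 id.
  apply/eqaddoP => e e0; have := H _ e0.
  rewrite [in X in X -> _](near_shift 0 x) subr0 => H'.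
  apply: filterS H' => h /=.
  by rewrite !fctE /= addrK opprD addrA.
have D := diff_unique Lc E.
by apply: DiffDef => //; apply/diff_locallyP; rewrite D.
Qed.

Lemma diff_remainder V W (f : V -> W) (x : V) : differentiable f x ->
  forall e, 0 < e -> \forall y \near x,
     `|f y - f x - 'd f x (y - x)| <= e * `|y - x|.
Proof.
move=> /diff_locallyP[_ /eqaddoP H] e e0.
have {}H := H e e0.
rewrite (near_shift 0 x) subr0; apply: filterS H => h /=.
by rewrite !fctE /= addrK opprD addrA.
Qed.

Lemma near_eq_is_diff V W (f g : V -> W) (x : V) :
  (\forall y \near x, f y = g y) -> differentiable f x -> is_diff x g ('d f x).
Proof.
move=> fg df; apply: is_diff_remainder; first exact: diff_continuous.
move=> e e0; have := diff_remainder df e0.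
have fgx : f x = g x by exact: nbhs_singleton fg.
by apply: filterS2 fg => y -> ; rewrite fgx.
Qed.

Lemma is_diff_linear V W (f : V -> W) (x : V) : linear f -> continuous f ->
  is_diff x f f.
Proof.
move=> lf cf; pose L : {linear V -> W} := HB.pack f (GRing.isLinear.Build _ _ _ _ f lf).
by apply: DiffDef; [exact: (@linear_differentiable _ _ _ L)|exact: (@diff_lin _ _ _ L)].
Qed.

(** Continuous differentiability in the sense of tangent maps: the tangent map
    is a function on the product of the space with itself, so that the chain
    rule is the functoriality of the tangent map and no basis is ever chosen. *)
Fixpoint frechet_C (k : nat) V W (f : V -> W) (A : set V) : Prop :=
  if k is k'.+1 then
    (forall x, A x -> differentiable f x) /\
    frechet_C k' (fun z : V * V => 'd f (z.1) (z.2)) (A `*` setT)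
  else forall x, A x -> {for x, continuous f}.

Lemma frechet_CW k V W (f : V -> W) (A B : set V) : B `<=` A ->
  frechet_C k f A -> frechet_C k f B.
Proof.
elim: k V W f A B => [|k IH] V W f A B BA /=; first by move=> H x /BA/H.
move=> [H1 H2]; split; first by move=> x /BA/H1.
by apply: IH H2 => -[x y] [/= /BA].
Qed.

Lemma open_prodT V (A : set V) : open A -> open (A `*` [set: V]).
Proof.
move=> oA; rewrite (_ : _ `*` _ = fst @^-1` A).
  by apply: open_comp => // x _; exact: cvg_fst.
by apply/seteqP; split=> [[x y] []|[x y]].
Qed.

Lemma frechet_C_eq k V W (f g : V -> W) (A : set V) : open A ->
  (forall x, A x -> f x = g x) -> frechet_C k f A -> frechet_C k g A.
Proof.
elim: k V W f g A => [|k IH] V W f g A oA fg /=.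
  move=> H x Ax; have fgx : \forall y \near x, f y = g y.
    by apply: filterS (open_nbhs_nbhs (conj oA Ax)) => y /fg.
  have : f @ x --> g x by rewrite -(fg x Ax); exact: H.
  by apply: cvg_trans; apply: near_eq_cvg; apply: filterS fgx => y ->.
have D x : A x -> differentiable f x -> is_diff x g ('d f x).
  move=> Ax; apply: near_eq_is_diff.
  by apply: filterS (open_nbhs_nbhs (conj oA Ax)) => y /fg.
move=> [H1 H2]; split.
  by move=> x Ax; have [] := D x Ax (H1 x Ax).
apply: IH H2; first exact: open_prodT.
by move=> [x y] [/= Ax _]; have [_ ->] := D x Ax (H1 x Ax).
Qed.

Lemma frechet_C_is_diff k V W (f : V -> W) (df : V -> V -> W) (A : set V) :
  open A -> (forall x, A x -> is_diff x f (df x)) ->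
  frechet_C k (fun z : V * V => df z.1 z.2) (A `*` setT) ->
  frechet_C k.+1 f A.
Proof.
move=> oA H1 H2; split; first by move=> x /H1[].
apply: frechet_C_eq H2; first exact: open_prodT.
by move=> [x y] [/= Ax _]; have [_ ->] := H1 x Ax.
Qed.

Lemma frechet_C_cst k V W (c : W) (A : set V) : open A ->
  frechet_C k (fun=> c) A.
Proof.
elim: k V W c A => [|k IH] V W c A oA; first by move=> x _; exact: cst_continuous.
apply: (@frechet_C_is_diff _ _ _ _ (fun _ _ => 0)) => //.
by apply: IH; exact: open_prodT.
Qed.

Lemma frechet_C_linear k V W (f : {linear V -> W}) (A : set V) : open A ->
  continuous f -> frechet_C k f A.
Proof.
elim: k V W f A => [|k IH] V W f A oA fc; first by move=> x _; exact: fc.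
apply: (@frechet_C_is_diff _ _ _ _ (fun=> f)) => //.
  move=> x _; apply: DiffDef; first exact: linear_differentiable.
  exact: diff_lin.
have lin : linear (fun z : V * V => f z.2).
  by move=> a [x y] [z t] /=; rewrite linearP.
apply: (IH _ _ (HB.pack (fun z : V * V => f z.2)
  (GRing.isLinear.Build _ _ _ _ _ lin))); first exact: open_prodT.
by move=> [x y]; apply: (@continuous_comp _ _ _ snd f); [exact: cvg_snd|exact: fc].
Qed.

Lemma frechet_C_id k V (A : set V) : open A -> frechet_C k (fun x : V => x) A.
Proof. by move=> oA; apply: (frechet_C_linear k (f := idfun)) => // x; exact: cvg_id. Qed.

Lemma frechet_C_fst k V W (A : set (V * W)) : open A ->
  frechet_C k (fst : V * W -> V) A.
Proof. by move=> oA; apply: (frechet_C_linear k (f := fst)) => // x; exact: cvg_fst. Qed.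

Lemma frechet_C_snd k V W (A : set (V * W)) : open A ->
  frechet_C k (snd : V * W -> W) A.
Proof. by move=> oA; apply: (frechet_C_linear k (f := snd)) => // x; exact: cvg_snd. Qed.

Lemma frechet_C_cont k V W (f : V -> W) (A : set V) x : frechet_C k f A -> A x ->
  {for x, continuous f}.
Proof.
by case: k => [|k] /=; [exact|move=> [H _] /H /differentiable_continuous].
Qed.

Lemma frechet_CS k V W (f : V -> W) (A : set V) :
  frechet_C k.+1 f A -> frechet_C k f A.
Proof.
elim: k V W f A => [|k IH] V W f A.
  by move=> H x; apply: frechet_C_cont H.
by move=> [H1 H2]; split=> //; apply: IH.
Qed.

Lemma frechet_C_pair k V W Z (f : V -> W) (g : V -> Z) (A : set V) : open A ->
  frechet_C k f A -> frechet_C k g A -> frechet_C k (fun x => (f x, g x)) A.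
Proof.
elim: k V W Z f g A => [|k IH] V W Z f g A oA.
  by move=> Hf Hg x Ax; apply: cvg_pair; [exact: Hf|exact: Hg].
move=> [Hf Hf'] [Hg Hg'].
apply: (@frechet_C_is_diff _ _ _ _ (fun x y => ('d f x y, 'd g x y))) => //.
  move=> x Ax; apply: is_diff_pair; apply: differentiableP; [exact: Hf|exact: Hg].
by apply: IH => //; exact: open_prodT.
Qed.

(** The tangent map of a composition is the composition of the tangent maps, so
    the chain rule at order [k] gives the one at order [k + 1]. *)
Lemma frechet_C_comp k U V W (f : U -> V) (g : V -> W) (A : set U) (B : set V) :
  open A -> open B -> (forall x, A x -> B (f x)) ->
  frechet_C k f A -> frechet_C k g B -> frechet_C k (g \o f) A.
Proof.
elim: k U V W f g A B => [|k IH] U V W f g A B oA oB AB.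
  move=> Hf Hg x Ax; apply: continuous_comp; [exact: Hf|exact/Hg/AB].
move=> Hf Hg.
apply: (@frechet_C_is_diff _ _ _ _ (fun x y => 'd g (f x) ('d f x y))) => //.
  move=> x Ax; apply: (@is_diff_comp _ _ _ _ f _ g); apply: differentiableP.
    exact: Hf.1.
  by apply: Hg.1; exact: AB.
apply: (IH _ _ _ (fun z : U * U => (f z.1, 'd f (z.1) (z.2)))
  (fun z => 'd g (z.1) (z.2)) (A `*` setT) (B `*` setT)).
- exact: open_prodT.
- exact: open_prodT.
- by move=> [x y] [/= Ax _]; split=> //; exact: AB.
- apply: frechet_C_pair; [exact: open_prodT| |exact: Hf.2].
  apply: (IH _ _ _ fst f _ A) => //; first exact: open_prodT.
  + by move=> [x y] [].
  + exact: frechet_C_fst (open_prodT oA).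
  + exact: frechet_CS.
- exact: Hg.2.
Qed.

Lemma frechet_C_add k V W (f g : V -> W) (A : set V) : open A ->
  frechet_C k f A -> frechet_C k g A -> frechet_C k (fun x => f x + g x) A.
Proof.
elim: k V W f g A => [|k IH] V W f g A oA.
  by move=> Hf Hg x Ax; apply: continuousD; [exact: Hf|exact: Hg].
move=> [Hf Hf'] [Hg Hg'].
apply: (@frechet_C_is_diff _ _ _ _ (fun x y => 'd f x y + 'd g x y)) => //.
  by move=> x Ax; apply: is_diffD; apply: differentiableP; [exact: Hf|exact: Hg].
by apply: IH => //; exact: open_prodT.
Qed.

Lemma is_diff_scale V W (a : V -> R) (f : V -> W) x :
  differentiable a x -> differentiable f x ->
  is_diff x (fun y => a y *: f y) (fun y => a x *: 'd f x y + 'd a x y *: f x).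
Proof.
move=> da df.
have lin : linear (fun y => a x *: 'd f x y + 'd a x y *: f x).
  move=> c y z; rewrite !linearPZ/= !scalerDl !scalerA [a x * c]mulrC.
  by rewrite addrACA.
pose L : {linear V -> W} := HB.pack (fun y => a x *: 'd f x y + 'd a x y *: f x)
  (GRing.isLinear.Build _ _ _ _ _ lin).
apply: (@is_diff_remainder _ _ _ _ L).
  move=> y; apply: (@continuousD _ _ _ (fun y => a x *: 'd f x y)
    (fun y => 'd a x y *: f x)).
    by apply: continuousZl_tmp; exact: diff_continuous.
  by apply: continuousZr_tmp; exact: diff_continuous.
move=> e e0.
(* The remainder of the product is split into the remainder of [f] times [a x],
   the remainder of [a] times [f y], and [da * (f y - f x)]; each of the three is
   bounded by a third of [e * `|y - x|]. *)
have [k k0 Hk] := linear_lipschitz (diff_continuous da).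
have e1 : 0 < e / 3 / (`|a x| + 1) by rewrite !divr_gt0 // ltr_pwDr.
have e2 : 0 < e / 3 / (`|f x| + 1) by rewrite !divr_gt0 // ltr_pwDr.
have e3 : 0 < e / 3 / k by rewrite !divr_gt0.
have fc := differentiable_continuous df.
near=> y.
rewrite /L /=.
have -> : a y *: f y - a x *: f x - (a x *: 'd f x (y - x) + 'd a x (y - x) *: f x)
  = a x *: (f y - f x - 'd f x (y - x)) + ((a y - a x - 'd a x (y - x)) *: f y
     + 'd a x (y - x) *: (f y - f x)).
  rewrite !scalerBr !scalerBl !opprD !addrA.
  set t1 := a y *: f y; set t2 := a x *: f x; set t3 := _ *: 'd f x _.
  set t4 := _ *: f x; set t5 := a x *: f y; set t6 := _ *: f y.
  rewrite [RHS](ACl (4*2*3*8*(1*5)*(7*6)))/=.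
  by rewrite !subrr !addr0.
apply: le_trans (ler_normD _ _) _.
apply: le_trans (lerD (lexx _) (ler_normD _ _)) _.
rewrite !normrZ.
have -> : e * `|y - x| = e / 3 * `|y - x| + (e / 3 * `|y - x| + e / 3 * `|y - x|).
  by field.
apply: lerD; [|apply: lerD].
- have : `|f y - f x - 'd f x (y - x)| <= e / 3 / (`|a x| + 1) * `|y - x|.
    by near: y; exact: diff_remainder.
  move=> /(ler_wpM2l (normr_ge0 (a x))) /le_trans; apply.
  rewrite mulrA; apply: ler_wpM2r => //.
  rewrite mulrCA ger_pMr; last by rewrite divr_gt0.
  by rewrite ler_pdivrMr ?ltr_pwDr // mul1r lerDl.
- have : `|a y - a x - 'd a x (y - x)| <= e / 3 / (`|f x| + 1) * `|y - x|.
    by near: y; exact: diff_remainder.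
  move=> h1; have h2 : `|f y| <= `|f x| + 1.
    have : `|f x - f y| < 1.
      by near: y; move/cvgrPdist_lt: fc; apply.
    move=> h; rewrite -[f y](subrK (f x)); apply: le_trans (ler_normD _ _) _.
    by rewrite distrC addrC lerD2l ltW.
  apply: le_trans (ler_pM _ _ h1 h2) _ => //.
  by rewrite mulrAC divfK // gt_eqF // ltr_pwDr.
- have h : `|f y - f x| <= e / 3 / k.
    by rewrite distrC; near: y; move/cvgrPdist_le: fc; apply.
  apply: le_trans (ler_pM _ _ (Hk _) h) _ => //.
  by rewrite mulrC mulrA divfK // gt_eqF.
Unshelve. all: by end_near. Qed.

Lemma frechet_C_scale k V W (a : V -> R) (f : V -> W) (A : set V) : open A ->
  frechet_C k a A -> frechet_C k f A -> frechet_C k (fun x => a x *: f x) A.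
Proof.
elim: k V W a f A => [|k IH] V W a f A oA.
  by move=> Ha Hf x Ax; apply: cvgZ; [exact: Ha|exact: Hf].
move=> Ha Hf.
have fstC U (g : V -> U) : frechet_C k.+1 g A ->
    frechet_C k (g \o fst : V * V -> U) (A `*` setT).
  move=> /frechet_CS Hg; apply: (frechet_C_comp (B := A)) => //.
  - exact: open_prodT.
  - by move=> x [].
  - exact: frechet_C_fst (open_prodT oA).
apply: (@frechet_C_is_diff _ _ _ _
    (fun x y => a x *: 'd f x y + 'd a x y *: f x)) => //.
  by move=> x Ax; apply: is_diff_scale; [exact: Ha.1|exact: Hf.1].
apply: frechet_C_add; first exact: open_prodT.
  apply: IH; [exact: open_prodT|exact: fstC Ha|exact: Hf.2].
apply: IH; [exact: open_prodT|exact: Ha.2|exact: fstC Hf].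
Qed.

Lemma frechet_C_inv k : frechet_C k (GRing.inv : R -> R) [set x | x != 0].
Proof.
have o0 : open [set x : R | x != 0] by exact: open_neq.
elim: k => [|k IH].
  by move=> x /= x0; apply: differentiable_continuous; exact: differentiable_Rinv.
have oT := open_prodT o0.
apply: (frechet_C_is_diff (df := fun x y : R => (- (x^-1 *: x^-1)) *: y) o0).
  move=> x /= x0; apply: DiffDef; first exact: differentiable_Rinv.
  rewrite diff_Rinv //; apply/funext => y; congr (- _ *: y).
  by rewrite -[RHS]/(x^-1 * x^-1) -expr2 exprVn.
have fstC : frechet_C k (GRing.inv \o fst : R * R -> R) ([set x | x != 0] `*` setT).
  apply: (frechet_C_comp (B := [set x | x != 0])) => //; first by move=> x [].
  exact: frechet_C_fst.
apply: frechet_C_scale => //; last first.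
  exact: frechet_C_snd.
rewrite (_ : (fun z : R * R => - (z.1^-1 *: z.1^-1)) =
   fun z => (-1) *: (z.1^-1 *: z.1^-1)); last by apply/funext => z; rewrite scaleN1r.
apply: frechet_C_scale => //; first exact: frechet_C_cst.
by apply: frechet_C_scale.
Qed.

(** On a line the tangent map is multiplication by the derivative. *)
Lemma frechet_C_derive1n (f : R -> R) :
  (forall n z, derivable (f^`(n)%classic) z 1) ->
  forall k, frechet_C k f setT.
Proof.
move=> H k.
suff: forall n, frechet_C k (f^`(n)%classic) setT by move=> /(_ 0%N).
elim: k => [|k IH] n.
  by move=> x _; apply/differentiable_continuous/derivable1_diffP/H.
apply: (frechet_C_is_diff (df := fun x y : R => y *: f^`(n.+1)%classic x) openT).
- move=> x _; have /derivable1_diffP d := H n x; apply: DiffDef => //.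
  exact: diff1E.
have oT := open_prodT (@openT R).
apply: frechet_C_scale => //.
  exact: frechet_C_snd.
apply: (frechet_C_comp (f := fst) (B := setT)) => //; first exact: openT.
exact: frechet_C_fst.
Qed.

(** A directional derivative is the tangent map composed with the affine map
    that freezes the direction. *)
Lemma frechet_C_class_C k V W (f : V -> W) (A : set V) : open A ->
  frechet_C k f A -> class_C k f A.
Proof.
elim: k V W f A => [|k IH] V W f A oA; first by move=> H; split.
move=> [H1 H2] /=; split; first by move=> x /H1/differentiable_continuous.
move=> v; split; first by move=> x /H1/diff_derivable.
apply: IH => //.
apply: (@frechet_C_eq _ _ _ ((fun z : V * V => 'd f (z.1) (z.2)) \o (fun x => (x, v)))) => //.
  by move=> x /H1 d; rewrite deriveE.
apply: frechet_C_comp H2 => //; first exact: open_prodT.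
apply: frechet_C_pair => //; last exact: frechet_C_cst.
exact: frechet_C_id.
Qed.

End FrechetSmoothness.

(** * Germs of smooth maps *)

Section SmoothGerms.
Context {R : realType}.
Implicit Types U V W Z : normedModType R.

(** One neighbourhood serves for all orders at once. *)
Definition smooth_at V W (f : V -> W) (a : V) : Prop :=
  exists A : set V, open_nbhs a A /\ forall k, frechet_C k f A.

Lemma smooth_at_smooth_near V W (f : V -> W) a : smooth_at f a -> smooth_near a f.
Proof.
move=> [A [[oA Aa] H]]; exists A; split=> // k.
exact: frechet_C_class_C.
Qed.

Lemma smooth_at_eq V W (f g : V -> W) a : (\forall x \near a, f x = g x) ->
  smooth_at f a -> smooth_at g a.
Proof.
move=> fg [A [[oA Aa] H]]; exists (A `&` [set x | f x = g x]^°); split.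
  by split; [apply: openI => //; exact: open_interior|split].
move=> k; apply: (frechet_C_eq (f := f)).
- by apply: openI => //; exact: open_interior.
- by move=> x [_ /interior_subset].
- by apply: frechet_CW (H k) => x [].
Qed.

Lemma smooth_at_ext V W (f g : V -> W) a : (forall x, f x = g x) ->
  smooth_at f a -> smooth_at g a.
Proof. by move=> fg; apply: smooth_at_eq; apply: nearW. Qed.

Lemma smooth_at_cst V W (c : W) (a : V) : smooth_at (fun=> c) a.
Proof. by exists setT; split=> [|k]; [split=> //; exact: openT|exact: frechet_C_cst openT]. Qed.

Lemma smooth_at_linear V W (f : V -> W) (a : V) : linear f -> continuous f ->
  smooth_at f a.
Proof.
move=> lf cf; exists setT; split=> [|k]; first by split=> //; exact: openT.
apply: (@frechet_C_linear _ k _ _ (HB.pack f (GRing.isLinear.Build _ _ _ _ f lf))) => //.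
exact: openT.
Qed.

Lemma smooth_at_id V (a : V) : smooth_at (fun x : V => x) a.
Proof. by apply: smooth_at_linear => // x; exact: cvg_id. Qed.

Lemma smooth_at_comp U V W (f : U -> V) (g : V -> W) a :
  smooth_at f a -> smooth_at g (f a) -> smooth_at (fun x => g (f x)) a.
Proof.
move=> [A [[oA Aa] Hf]] [B [[oB Bfa] Hg]].
have fc x : A x -> {for x, continuous f} by exact: Hf 0%N x.
pose A' := A `&` f @^-1` B.
have oA' : open A'.
  rewrite openE => x [Ax Bx]; apply: filterI.
    exact: open_nbhs_nbhs.
  by apply: (fc x Ax); exact: open_nbhs_nbhs.
exists A'; split => // k.
apply: (frechet_C_comp (f := f) (g := g) oA' oB) => //.
  by move=> x [].
by apply: frechet_CW (Hf k) => x [].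
Qed.

Lemma smooth_at_fst U V W (f : U -> V * W) a : smooth_at f a ->
  smooth_at (fun x => (f x).1) a.
Proof.
move=> H; apply: (smooth_at_comp (g := fst)) H _.
by apply: smooth_at_linear => // x; exact: cvg_fst.
Qed.

Lemma smooth_at_snd U V W (f : U -> V * W) a : smooth_at f a ->
  smooth_at (fun x => (f x).2) a.
Proof.
move=> H; apply: (smooth_at_comp (g := snd)) H _.
by apply: smooth_at_linear => // x; exact: cvg_snd.
Qed.

Lemma smooth_at_combine V W Z (P : (V -> W) -> (V -> Z) -> set V -> Prop) a f g :
  (forall A, open A -> (forall k, frechet_C k f A) -> (forall k, frechet_C k g A) ->
    P f g A) ->
  smooth_at f a -> smooth_at g a -> exists A, open_nbhs a A /\ P f g A.
Proof.
move=> H [A [[oA Aa] Hf]] [B [[oB Ba] Hg]].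
exists (A `&` B); split; first by split=> //; exact: openI.
apply: H; first exact: openI.
  by move=> k; apply: frechet_CW (Hf k) => x [].
by move=> k; apply: frechet_CW (Hg k) => x [].
Qed.

Lemma smooth_at_pair V W Z (f : V -> W) (g : V -> Z) a :
  smooth_at f a -> smooth_at g a -> smooth_at (fun x => (f x, g x)) a.
Proof.
apply: (smooth_at_combine (P := fun f g A => forall k, frechet_C k (fun x => (f x, g x)) A)).
by move=> A oA Hf Hg k; exact: frechet_C_pair.
Qed.

Lemma smooth_at_add V W (f g : V -> W) a :
  smooth_at f a -> smooth_at g a -> smooth_at (fun x => f x + g x) a.
Proof.
apply: (smooth_at_combine (P := fun f g A => forall k, frechet_C k (fun x => f x + g x) A)).
by move=> A oA Hf Hg k; exact: frechet_C_add.
Qed.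

Lemma smooth_at_scale V W (f : V -> R) (g : V -> W) a :
  smooth_at f a -> smooth_at g a -> smooth_at (fun x => f x *: g x) a.
Proof.
apply: (smooth_at_combine (P := fun (f : V -> R) g A =>
  forall k, frechet_C k (fun x => f x *: g x) A)).
by move=> A oA Hf Hg k; exact: frechet_C_scale.
Qed.

Lemma smooth_at_mul V (f g : V -> R) a :
  smooth_at f a -> smooth_at g a -> smooth_at (fun x => f x * g x) a.
Proof. exact: (@smooth_at_scale V R f g). Qed.

Lemma smooth_at_opp V W (f : V -> W) a : smooth_at f a -> smooth_at (fun x => - f x) a.
Proof.
move=> H; apply: (@smooth_at_ext _ _ (fun x => (-1 : R) *: f x)).
  by move=> x; rewrite scaleN1r.
by apply: smooth_at_scale => //; exact: smooth_at_cst.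
Qed.

Lemma smooth_at_sub V W (f g : V -> W) a :
  smooth_at f a -> smooth_at g a -> smooth_at (fun x => f x - g x) a.
Proof. by move=> Hf Hg; apply: smooth_at_add => //; exact: smooth_at_opp. Qed.

Lemma smooth_at_exp V (f : V -> R) n a : smooth_at f a ->
  smooth_at (fun x => f x ^+ n) a.
Proof.
move=> H; elim: n => [|n IH].
  apply: (@smooth_at_ext V R (fun=> 1)); last exact: smooth_at_cst.
  by move=> x; rewrite expr0.
apply: (@smooth_at_ext V R (fun x => f x * f x ^+ n)).
  by move=> x; rewrite exprS.
exact: smooth_at_mul.
Qed.

Lemma smooth_at_inv V (f : V -> R) a : f a != 0 -> smooth_at f a ->
  smooth_at (fun x => (f x)^-1) a.
Proof.
move=> fa0 H; apply: (@smooth_at_comp V R R f GRing.inv a H).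
exists [set x | x != 0]; split; last exact: frechet_C_inv.
by split=> //; exact: open_neq.
Qed.

Lemma smooth_at_sum V W (I : Type) (r : seq I) (P : pred I) (f : I -> V -> W) a :
  (forall i, P i -> smooth_at (f i) a) -> smooth_at (fun x => \sum_(i <- r | P i) f i x) a.
Proof.
move=> H; elim: r => [|i r IH].
  apply: (@smooth_at_ext V W (fun=> 0)); last exact: smooth_at_cst.
  by move=> x; rewrite big_nil.
case Pi : (P i); last first.
  by apply: smooth_at_ext IH => x; rewrite big_cons Pi.
apply: (@smooth_at_ext _ _ (fun x => f i x + \sum_(j <- r | P j) f j x)).
  by move=> x; rewrite big_cons Pi.
by apply: smooth_at_add => //; exact: H.
Qed.

Lemma smooth_at_continuous V W (f : V -> W) a : smooth_at f a ->
  {for a, continuous f}.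
Proof. by move=> [A [[oA Aa] H]]; exact: (H 0%N). Qed.

Lemma smooth_at_differentiable V W (f : V -> W) a : smooth_at f a ->
  differentiable f a.
Proof. by move=> [A [[oA Aa] H]]; apply: (H 1%N).1. Qed.

Lemma smooth_at_near V W (f : V -> W) a : smooth_at f a ->
  \forall x \near a, smooth_at f x.
Proof.
move=> [A [[oA Aa] H]]; apply: filterS (open_nbhs_nbhs (conj oA Aa)) => x Ax.
by exists A.
Qed.

Lemma smooth_at_derive V W (f : V -> W) a v : smooth_at f a ->
  smooth_at ('D_v f) a.
Proof.
move=> Hf; apply: (@smooth_at_eq _ _ (fun x => 'd f x v)).
  apply: filterS (smooth_at_near Hf) => x /smooth_at_differentiable d.
  by rewrite deriveE.
case: Hf => A [[oA Aa] H].
apply: (smooth_at_comp (f := fun x : V => (x, v)) (g := fun z : V * V => 'd f (z.1) (z.2))).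
  by apply: smooth_at_pair; [exact: smooth_at_id|exact: smooth_at_cst].
exists (A `*` setT); split.
  by split=> //; exact: open_prodT.
by move=> k; exact: (H k.+1).2.
Qed.

Lemma frechet_C_smooth_at (f : R -> R) : (forall k, frechet_C k f setT) ->
  forall a, smooth_at f a.
Proof. by move=> H a; exists setT; split=> //; split=> //; exact: openT. Qed.

Lemma cV_basis n (w : 'cV[R]_n) : w = \sum_i w i 0 *: delta_mx i 0.
Proof.
rewrite [LHS]matrix_sum_delta; apply: eq_bigr => i _.
by rewrite big_ord1.
Qed.

(** A linear map on column vectors is a finite combination of coordinates. *)
Lemma linear_cV_continuous n W (f : 'cV[R]_n -> W) : linear f -> continuous f.
Proof.
move=> lf; pose L : {linear 'cV[R]_n -> W} :=
  HB.pack f (GRing.isLinear.Build _ _ _ _ f lf).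
have -> : f = fun w => \sum_i w i 0 *: f (delta_mx i 0).
  apply/funext => w; rewrite {1}[w]cV_basis -[LHS]/(L _) linear_sum.
  by apply: eq_bigr => i _; rewrite linearZ.
apply: continuous_big => [|i _ w]; first exact: add_continuous.
apply: (@cvgZr_tmp _ _ _ (nbhs w) (nbhs_filter w)).
by apply: (@coord_continuous R n 1 i 0 w).
Qed.

Lemma is_diff_linear_cV n W (f : 'cV[R]_n -> W) (x : 'cV[R]_n) : linear f ->
  is_diff x f f.
Proof. by move=> lf; apply: is_diff_linear => //; exact: linear_cV_continuous. Qed.

Lemma linear_cV_mx n (f : 'cV[R]_n -> 'cV[R]_n) : linear f ->
  exists M : 'M[R]_n, forall w, M *m w = f w.
Proof.
move=> lf; pose L : {linear 'cV[R]_n -> 'cV[R]_n} :=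
  HB.pack f (GRing.isLinear.Build _ _ _ _ f lf).
exists (\matrix_(i, j) f (delta_mx j 0) i 0) => w.
rewrite {2}[w]cV_basis -[f _]/(L _) linear_sum.
apply/colP => i; rewrite !mxE summxE; apply: eq_bigr => j _.
by rewrite linearZ /= !mxE mulrC.
Qed.

Lemma smooth_at_linear_cV V n W (L : 'cV[R]_n -> W) (f : V -> 'cV[R]_n) a :
  linear L -> smooth_at f a -> smooth_at (fun x => L (f x)) a.
Proof.
move=> lL H; apply: smooth_at_comp H _.
by apply: smooth_at_linear => //; exact: linear_cV_continuous.
Qed.

Lemma smooth_at_coord V n (f : V -> 'cV[R]_n) i a :
  smooth_at f a -> smooth_at (fun x => f x i 0) a.
Proof.
apply: (smooth_at_linear_cV (L := fun y : 'cV[R]_n => y i 0)).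
by move=> c x y; rewrite !mxE.
Qed.

Lemma smooth_at_cV V n (f : V -> 'cV[R]_n) a :
  (forall i, smooth_at (fun x => f x i 0) a) -> smooth_at f a.
Proof.
move=> H; apply: (@smooth_at_ext _ _ (fun x => \sum_i f x i 0 *: delta_mx i 0)).
  by move=> x; rewrite -cV_basis.
apply: smooth_at_sum => i _; apply: smooth_at_scale => //.
exact: smooth_at_cst.
Qed.

End SmoothGerms.

(** * Implicit functions of one unknown *)

Section ImplicitFunction.
Context {R : realType}.

Lemma near_prod_bound (V W : normedModType R) (P : V * W -> Prop) (x0 : V) (u0 : W) :
  (\forall z \near (x0, u0), P z) -> exists2 e : R, 0 < e &
    forall x u, `|x - x0| < e -> `|u - u0| < e -> P (x, u).
Proof.
move=> /nbhs_ballP[e /= e0 He]; exists e => // x u xe ue.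
by apply: He; split; rewrite -ball_normE /= distrC.
Qed.

Lemma diff_pairr (Q W : normedModType R) (f : Q * R -> W) (z : Q * R) (t : R) :
  differentiable f z -> 'd f z (0, t) = t *: 'd f z (0, 1).
Proof.
move=> df; rewrite -linearZ; congr ('d f z _).
by apply/pair_equal_spec; split; rewrite /= ?scaler0 // /GRing.scale/= mulr1.
Qed.

Lemma is_derive_section (Q W : normedModType R) (f : Q * R -> W) (q : Q) (t : R) :
  differentiable f (q, t) ->
  is_derive t 1 (fun s : R => f (q, s)) ('d f (q, t) (0, 1)).
Proof.
move=> df.
have H : is_diff t (f \o (fun s : R => (q, s))) ('d f (q, t) \o (fun s => (0, s))).
  by apply: is_diff_comp; apply: differentiableP.
case: H => H1 H2; apply: DeriveDef; first exact: diff_derivable.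
by rewrite deriveE // H2.
Qed.

(** For a solution branch that is merely continuous, differentiability of the
    equation at one point already forces differentiability of the branch. *)
Lemma implicit_is_diff (Q : normedModType R) (f : Q * R -> R) (tau : Q -> R) (q : Q) :
  differentiable f (q, tau q) -> {for q, continuous tau} ->
  0 < 'd f (q, tau q) (0, 1) ->
  (\forall q' \near q, f (q', tau q') = 0) ->
  is_diff q tau (fun h => - (('d f (q, tau q) (0, 1))^-1 * 'd f (q, tau q) (h, 0))).
Proof.
set z := (q, tau q); set B := 'd f z (0, 1) => df tc B0 f0.
pose L h := - (B^-1 * 'd f z (h, 0)).
have lin1 : linear (fun h : Q => (h, 0 : R)).
  by move=> c x y; apply/pair_equal_spec; split; rewrite //= scaler0 addr0.
have lin : linear L.
  move=> c x y; rewrite /L lin1 linearPZ /= mulrDr opprD; congr (_ + _).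
  by rewrite /GRing.scale /= mulrCA mulrN.
pose LL : {linear Q -> R} := HB.pack L (GRing.isLinear.Build _ _ _ _ L lin).
have Lc : continuous LL.
  move=> h; apply: smooth_at_continuous; rewrite /LL /= /L.
  apply: smooth_at_opp; apply: smooth_at_mul; first exact: smooth_at_cst.
  apply: (smooth_at_comp (f := fun h : Q => (h, 0 : R)) (g := 'd f z)).
    by apply: smooth_at_pair; [exact: smooth_at_id|exact: smooth_at_cst].
  by apply: smooth_at_linear; [exact: linearP|exact: diff_continuous].
apply: (@is_diff_remainder _ _ _ _ _ LL Lc) => e e0.
have [K K0 HK] := linear_lipschitz Lc.
(* [del] appears on both sides of the estimate for [del - L h]: the bound 1/2
   absorbs it on the left, and the second bound then yields [e]. *)
pose eta := Num.min (1 / 2) (e / (2 * (1 + K))).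
have K1 : 0 < 1 + K by rewrite addr_gt0.
have eta0 : 0 < eta by rewrite /eta lt_min !divr_gt0 ?mulr_gt0.
have tz : (q', tau q') @[q' --> q] --> z.
  exact: (cvg_pair cvg_id tc).
have Be : 0 < B * eta by rewrite mulr_gt0.
have rem : \forall q' \near q,
    `|f (q', tau q') - f z - 'd f z ((q', tau q') - z)| <= B * eta * `|(q', tau q') - z|.
  exact: (tz _ (diff_remainder df Be)).
have fz : f z = 0 by exact: (nbhs_singleton f0).
near=> q'.
have H : `|'d f z ((q', tau q') - z)| <= B * eta * `|(q', tau q') - z|.
  have fq' : f (q', tau q') = 0 by near: q'.
  rewrite -normrN -sub0r -(subrr 0) -{1}fq' -fz.
  by near: q'.
set h := q' - q; set del := tau q' - tau q.
have dfh : 'd f z ((q', tau q') - z) = B * (del - L h).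
  have -> : (q', tau q') - z = (h, 0) + (0, del).
    by apply/pair_equal_spec; split; rewrite /= ?addr0 ?add0r.
  rewrite linearD diff_pairr // -/B /L opprK mulrDr mulVKf ?gt_eqF //.
  by rewrite addrC mulrC.
have nz : `|(q', tau q') - z| <= `|h| + `|del|.
  by rewrite /z prod_normE /= ge_max lerDl lerDr !normr_ge0.
have {}H : `|del - L h| <= eta * (`|h| + `|del|).
  rewrite -(ler_pM2l B0) mulrA -{1}(gtr0_norm B0) -normrM -dfh.
  apply: le_trans H _.
  by apply: ler_wpM2l => //; exact: ltW.
have dL : `|del| <= `|del - L h| + K * `|h|.
  rewrite -{1}[del](subrK (L h)); apply: le_trans (ler_normD _ _) _.
  by rewrite lerD2l; exact: HK.
rewrite -/(L _) -/h -/del [LL h]/(L h).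
have e1 : eta <= 1 / 2 by rewrite /eta ge_min lexx.
have e2 : eta * (2 * (1 + K)) <= e.
  by rewrite -ler_pdivlMr ?mulr_gt0 // /eta ge_min lexx orbT.
have arith (x y w u : R) : 0 <= x -> 0 <= w -> w <= u * (x + y) ->
    y <= w + K * x -> u <= 1 / 2 -> u * (2 * (1 + K)) <= e -> 0 < u -> w <= e * x.
  move=> x0 w0 H1 H2 H3 H4 u0.
  have H5 : w <= u * (x + w + K * x).
    by apply: le_trans H1 _; rewrite ler_pM2l // -addrA lerD2l.
  have H6 : u * w <= 1 / 2 * w by exact: ler_wpM2r.
  have H7 : u * (2 * (1 + K)) * x <= e * x by exact: ler_wpM2r.
  lra.
exact: (arith _ `|del| _ eta).
Unshelve. all: by end_near. Qed.

(** A continuous strictly monotone function of the last variable changes sign,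
    which gives the solution; its smoothness is bootstrapped from the formula
    for its differential. *)
Lemma implicit_scalar_pos (Q : normedModType R) (f : Q * R -> R) (q0 : Q) (t0 : R) :
  smooth_at f (q0, t0) -> f (q0, t0) = 0 ->
  0 < 'D_((0, 1) : Q * R) f (q0, t0) ->
  exists tau : Q -> R, [/\ smooth_at tau q0, tau q0 = t0 &
    \forall z \near (q0, t0), f z = 0 <-> z.2 = tau z.1].
Proof.
move=> sf f0 D0.
have gc := smooth_at_continuous (smooth_at_derive ((0, 1) : Q * R) sf).
have [A [[oA Aa] HA]] := sf.
have : \forall z \near (q0, t0), A z /\ 0 < 'D_((0, 1) : Q * R) f z.
  apply: filterI; first exact: open_nbhs_nbhs.
  exact: (cvgr_gt _ gc _ D0).
move=> /nbhs_ballP[e /= e0 He].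
have HAz q t : ball q0 e q -> ball t0 e t -> A (q, t).
  by move=> Hq Ht; apply: (He (q, t) _).1.
have dfz q t : ball q0 e q -> ball t0 e t -> differentiable f (q, t).
  by move=> Hq Ht; apply: (HA 1%N).1; exact: HAz.
have Dpos q t : ball q0 e q -> ball t0 e t -> 0 < 'd f (q, t) (0, 1).
  move=> Hq Ht; rewrite -deriveE; last exact: dfz.
  exact: (He (q, t) _).2.
have fcq q t : ball q0 e q -> ball t0 e t -> {for t, continuous (fun t => f (q, t))}.
  move=> Hq Ht; have [d _] := is_derive_section (dfz _ _ Hq Ht).
  by apply/differentiable_continuous/derivable1_diffP.
have bc s t r : ball t0 e s -> ball t0 e t -> s <= r <= t -> ball t0 e r.
  rewrite -ball_normE /= !ltr_norml => /andP[s1 s2] /andP[t1 t2] /andP[r1 r2].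
  by apply/andP; split; lra.
have within q s t : ball q0 e q -> ball t0 e s -> ball t0 e t ->
    {within `[s, t], continuous (fun r => f (q, r))}.
  move=> Hq Hs Ht; apply/continuous_in_subspaceT => r; rewrite inE /= in_itv /= => Hr.
  by apply: fcq => //; exact: bc Hr.
have mono q s t : ball q0 e q -> ball t0 e s -> ball t0 e t -> s < t ->
    f (q, s) < f (q, t).
  move=> Hq Hs Ht st.
  have [||c Hc E] := @MVT R (fun r => f (q, r)) (fun r => 'd f (q, r) (0, 1)) s t st.
  - move=> r; rewrite in_itv /= => /andP[r1 r2].
    by apply: is_derive_section; apply: dfz => //; apply: (bc s t) => //; rewrite !ltW.
  - exact: within.
  rewrite -subr_gt0 E mulr_gt0 ?subr_gt0 //; apply: Dpos => //.
  by move: Hc; rewrite in_itv /= => /andP[r1 r2]; apply: (bc s t) => //; rewrite !ltW.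
have inj q s t : ball q0 e q -> ball t0 e s -> ball t0 e t ->
    f (q, s) = 0 -> f (q, t) = 0 -> s = t.
  move=> Hq Hs Ht fs ft; case: (ltgtP s t) => // st.
    by have := mono _ _ _ Hq Hs Ht st; rewrite fs ft ltxx.
  by have := mono _ _ _ Hq Ht Hs st; rewrite fs ft ltxx.
have root q s t : ball q0 e q -> ball t0 e s -> ball t0 e t -> s < t ->
    f (q, s) < 0 < f (q, t) -> exists2 r, s < r < t & f (q, r) = 0.
  move=> Hq Hs Ht st /andP[fs ft].
  have [||r Hr E] := @IVT R (fun r => f (q, r)) s t 0 (ltW st).
  - exact: within.
  - by rewrite ge_min le_max (ltW fs) (ltW ft) orbT.
  exists r => //; move: Hr; rewrite in_itv /= => /andP[r1 r2].
  rewrite !lt_neqAle r1 r2 !andbT; apply/andP; split.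
    by apply/eqP => sr; move: fs; rewrite sr E ltxx.
  by apply/eqP => sr; move: ft; rewrite -sr E ltxx.
have t00 : ball t0 e t0 by exact: ballxx.
have bm (t a : R) : ball t0 e t -> \forall d \near (0 : R), ball t0 e (t + a * d).
  move=> Ht.
  have : (fun d => t + a * d) @ (0 : R) --> t + a * 0.
    apply: (@smooth_at_continuous _ R R (fun d => t + a * d) 0).
    apply: smooth_at_add; first exact: smooth_at_cst.
    by apply: smooth_at_mul; [exact: smooth_at_cst|exact: smooth_at_id].
  rewrite mulr0 addr0; apply; apply: open_nbhs_nbhs; split=> //.
  exact: ball_open.
(* [t0] is a default value for the [q] at which there is no solution. *)
pose tau q := xget t0 [set t | ball t0 e t /\ f (q, t) = 0].
pose P q := ball q0 e q /\ exists2 t, ball t0 e t & f (q, t) = 0.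
have tauP q : P q -> ball t0 e (tau q) /\ f (q, tau q) = 0.
  by move=> [_ [t Ht ft]]; apply: (@xgetPex _ t0 [set t | ball t0 e t /\ f (q, t) = 0]); exists t.
have cont q : P q -> forall d, 0 < d -> \forall q' \near q,
    P q' /\ `|tau q - tau q'| < d.
  move=> Pq d d0; have [Hq _] := Pq; have [Ht ft] := tauP _ Pq.
  have /nbhs_ballP[r /= r0 Hr] : \forall d \near (0 : R),
      ball t0 e (tau q + 1 * d) /\ ball t0 e (tau q + (-1) * d).
    by apply: filterI; exact: bm.
  pose c := Num.min (r / 2) (d / 2).
  have c0 : 0 < c by rewrite lt_min !divr_gt0.
  have [b1 b2] : ball t0 e (tau q + c) /\ ball t0 e (tau q - c).
    have := Hr c; rewrite mul1r mulN1r; apply.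
    rewrite -ball_normE /= sub0r normrN gtr0_norm // gt_min.
    by rewrite ltr_pdivrMr // ltr_pMr // ltr1n.
  have s1 : f (q, tau q - c) < 0.
    by rewrite -ft; apply: mono => //; rewrite ltrBlDr ltrDl.
  have s2 : 0 < f (q, tau q + c) by rewrite -ft; apply: mono => //; rewrite ltrDl.
  have cl t : ball t0 e t -> (fun q' : Q => f (q', t)) @ q --> f (q, t).
    move=> bt; apply: (@continuous_comp _ _ _ (fun q' : Q => (q', t)) f q).
      apply: (@smooth_at_continuous _ _ _ (fun q' : Q => (q', t)) q).
      by apply: smooth_at_pair; [exact: smooth_at_id|exact: smooth_at_cst].
    exact/differentiable_continuous/dfz.
  have n1 : \forall q' \near q, f (q', tau q - c) < 0.
    exact: (cvgr_lt _ (cl _ b2) _ s1).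
  have n2 : \forall q' \near q, 0 < f (q', tau q + c).
    exact: (cvgr_gt _ (cl _ b1) _ s2).
  have n3 : \forall q' \near q, ball q0 e q'.
    by apply: open_nbhs_nbhs; split=> //; exact: ball_open.
  near=> q'.
  have Hq' : ball q0 e q' by near: q'.
  have [||t /andP[t1 t2] Et] := root q' (tau q - c) (tau q + c) Hq' b2 b1.
  - lra.
  - by apply/andP; split; near: q'.
  have bt : ball t0 e t by apply: (bc _ _ t b2 b1); rewrite !ltW.
  have Pq' : P q' by split=> //; exists t.
  split=> //; have [Ht' ft'] := tauP _ Pq'.
  rewrite (inj _ _ _ Hq' Ht' bt ft' Et).
  have cd : c <= d / 2 by rewrite /c ge_min lexx orbT.
  by rewrite ltr_norml; apply/andP; split; lra.
(* The sign change at [tau q - c] and [tau q + c] persists near [q], so that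
   solvability is an open condition and [tau] is continuous. *)
have oP : open [set q | P q].
  by rewrite openE => q /= Pq; apply: filterS (cont _ Pq 1 ltr01) => q' [].
have P0 : P q0 by split; [exact: ballxx|exists t0].
have tau0 : tau q0 = t0.
  by have [H1 H2] := tauP _ P0; apply: inj H2 f0 => //; exact: ballxx.
have tc q : P q -> {for q, continuous tau}.
  move=> Pq; apply/cvgrPdist_lt => d d0.
  by apply: filterS (cont _ Pq d d0) => q' [].
have tdiff q : P q -> is_diff q tau
    (fun h => - (('d f (q, tau q) (0, 1))^-1 * 'd f (q, tau q) (h, 0))).
  move=> Pq; have [Hq _] := Pq; have [Ht ft] := tauP _ Pq.
  apply: implicit_is_diff; [exact: dfz|exact: tc|exact: Dpos|].
  by apply: filterS (cont _ Pq 1 ltr01) => q' [/tauP[]].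
exists tau; split=> //.
  (* The differential of [tau] is a rational expression in the tangent map of [f]
     along the graph of [tau], hence as smooth as [tau] itself. *)
  exists [set q | P q]; split=> //; elim=> [|k IH]; first by move=> q /tc.
  apply: (frechet_C_is_diff oP tdiff).
  have oPT := open_prodT oP.
  have fstC : frechet_C k (fst : Q * Q -> Q) ([set q | P q] `*` setT).
    exact: frechet_C_fst.
  have tfst : frechet_C k (tau \o fst : Q * Q -> R) ([set q | P q] `*` setT).
    by apply: (frechet_C_comp (B := [set q | P q])) => // x [].
  have Tf (v : Q * Q -> Q * R) : frechet_C k v ([set q | P q] `*` setT) ->
      frechet_C k (fun z => 'd f (z.1, tau z.1) (v z)) ([set q | P q] `*` setT).
    move=> Hv; apply: (frechet_C_comp (f := fun z => ((z.1, tau z.1), v z))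
      (g := fun z => 'd f (z.1) (z.2)) (B := A `*` setT)) => //.
    - exact: open_prodT.
    - move=> [x y] [/= Px _]; split=> //=; apply: HAz; first by case: Px.
      by have [] := tauP _ Px.
    - by apply: frechet_C_pair => //; exact: frechet_C_pair.
    - exact: (HA k.+1).2.
  apply: (@frechet_C_eq _ k _ _ (fun z : Q * Q => (-1) *: (('d f (z.1, tau z.1) (0, 1))^-1 *:
     'd f (z.1, tau z.1) (z.2, 0)))) => //.
    by move=> z _; rewrite scaleN1r.
  apply: frechet_C_scale => //; first exact: frechet_C_cst.
  apply: frechet_C_scale => //.
    apply: (frechet_C_comp (f := fun z : Q * Q => 'd f (z.1, tau z.1) (0, 1)) (g := GRing.inv)
      (B := [set x : R | x != 0]) oPT (@open_neq R 0)).
    - move=> [x y] [/= Px _]; rewrite gt_eqF //; apply: Dpos; first by case: Px.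
      by have [] := tauP _ Px.
    - by apply: Tf; exact: frechet_C_cst.
    - exact: frechet_C_inv.
  apply: Tf; apply: frechet_C_pair => //; last exact: frechet_C_cst.
  exact: frechet_C_snd.
have nP : \forall z \near (q0, t0), P z.1 /\ ball t0 e z.2.
  exists ([set q | P q], ball t0 e) => /=.
    by split; [exact: open_nbhs_nbhs|exact: nbhsx_ballx].
  by move=> [x y] [].
apply: filterS nP => -[q t] /= [Pq Ht]; have [H1 H2] := tauP _ Pq.
split=> [ft|->] //; apply: inj ft H2 => //.
by case: Pq.
Unshelve. all: by end_near. Qed.

Lemma implicit_scalar (Q : normedModType R) (f : Q * R -> R) (q0 : Q) (t0 : R) :
  smooth_at f (q0, t0) -> f (q0, t0) = 0 ->
  'D_((0, 1) : Q * R) f (q0, t0) != 0 ->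
  exists tau : Q -> R, [/\ smooth_at tau q0, tau q0 = t0 &
    \forall z \near (q0, t0), f z = 0 <-> z.2 = tau z.1].
Proof.
move=> sf f0 D0; case: (ltgtP 0 ('D_((0, 1) : Q * R) f (q0, t0))) => [|Dn|/esym/eqP].
- exact: implicit_scalar_pos.
- have [||| tau [H1 H2 H3]] := @implicit_scalar_pos Q (fun z => - f z) q0 t0.
  + exact: smooth_at_opp.
  + by rewrite f0 oppr0.
  + rewrite (deriveN (f := f)) ?oppr_gt0 //.
    exact/diff_derivable/smooth_at_differentiable.
  exists tau; split=> //; apply: filterS H3 => z <-; split=> [->|]; first by rewrite oppr0.
  by move/eqP; rewrite oppr_eq0 => /eqP.
- by rewrite (negPf D0).
Qed.

End ImplicitFunction.

(** * Implicit functions of several unknowns *)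

Section VectorImplicitFunction.
Context {R : realType}.

(** Moves one scalar unknown from the end of the triple to the front of the
    vector of the remaining ones. *)
Definition push_coord (Q : normedModType R) n (z : (Q * 'cV[R]_n) * R) : Q * 'cV[R]_n.+1 :=
  (z.1.1, col_mx (z.2%:M : 'cV[R]_1) z.1.2).

Lemma push_coord_smooth (Q : normedModType R) n z : smooth_at (@push_coord Q n) z.
Proof.
apply: smooth_at_pair.
  by apply: smooth_at_fst; apply: smooth_at_fst; exact: smooth_at_id.
apply: smooth_at_cV => i.
case: (split_ordP (i : 'I_(1 + n))) => j ->.
  apply: (@smooth_at_ext R _ R (fun z : (Q * 'cV[R]_n) * R => z.2)).
    by move=> x; rewrite /= (@col_mxEu R 1 n 1) mxE ord1 eqxx.
  by apply: smooth_at_snd; exact: smooth_at_id.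
apply: (@smooth_at_ext R _ R (fun z : (Q * 'cV[R]_n) * R => z.1.2 j 0)).
  by move=> x; rewrite /= (@col_mxEd R 1 n 1).
by apply: smooth_at_coord; apply: smooth_at_snd; apply: smooth_at_fst; exact: smooth_at_id.
Qed.

Lemma push_coord_linear (Q : normedModType R) n : linear (@push_coord Q n).
Proof.
move=> c x y; apply/pair_equal_spec; split=> //=.
by rewrite raddfD /= -scale_scalar_mx -(@add_col_mx R 1 n 1) -(@scale_col_mx R 1 n 1).
Qed.

Lemma push_coord_diff (Q : normedModType R) n z :
  is_diff z (@push_coord Q n) (@push_coord Q n).
Proof.
apply: is_diff_linear; first exact: push_coord_linear.
by move=> x; exact: (smooth_at_continuous (push_coord_smooth x)).
Qed.

(** Elimination of the unknowns one at a time: each step solves one scalar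
    equation for one coordinate, and an identity partial differential stays the
    identity after the substitution. *)
Lemma implicit_cV_id n (Q : normedModType R) (F : Q * 'cV[R]_n -> 'cV[R]_n)
    (q0 : Q) (w0 : 'cV[R]_n) :
  smooth_at F (q0, w0) -> F (q0, w0) = 0 ->
  (forall w, 'd F (q0, w0) (0, w) = w) ->
  exists g : Q -> 'cV[R]_n, [/\ smooth_at g q0, g q0 = w0 &
    \forall z \near (q0, w0), F z = 0 <-> z.2 = g z.1].
Proof.
elim: n Q F q0 w0 => [|n IH] Q F q0 w0 sF F0 dF.
  exists (fun=> w0); split=> //; first exact: smooth_at_cst.
  exists (setT, setT) => [|z _]; first by split; exact: filterT.
  by rewrite [F z]flatmx0 [z.2]flatmx0 [w0]flatmx0.
pose w0' : 'cV[R]_n := @dsubmx R 1 n 1 w0.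
pose t0 : R := w0 0 0.
have pushK (w : 'cV[R]_n.+1) : col_mx ((w 0 0)%:M : 'cV[R]_1) (@dsubmx R 1 n 1 w) = w.
  rewrite -[RHS](@vsubmxK R 1 n 1); congr col_mx.
  apply/matrixP => i j; rewrite !ord1 !mxE eqxx mulr1n; congr (w _ _); exact: val_inj.
have push0 : push_coord ((q0, w0'), t0) = (q0, w0).
  by rewrite /push_coord /= pushK.
pose f z := F (push_coord z) 0 0.
have sFp : smooth_at (fun z => F (push_coord z)) ((q0, w0'), t0).
  by apply: smooth_at_comp; [exact: push_coord_smooth|rewrite push0].
have sf : smooth_at f ((q0, w0'), t0) by apply: smooth_at_coord.
have dFp : is_diff ((q0, w0'), t0) (fun z => F (push_coord z))
    ('d F (q0, w0) \o @push_coord Q n).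
  apply: (@is_diff_comp _ _ _ _ (@push_coord Q n) _ F); first exact: push_coord_diff.
  by rewrite push0; apply: differentiableP; exact: smooth_at_differentiable.
have linc : linear (fun w : 'cV[R]_n.+1 => w 0 0) by move=> c x y; rewrite !mxE.
have Df : 'D_((0, 1) : (Q * 'cV[R]_n) * R) f ((q0, w0'), t0) = 1.
  have [d1 d2] := dFp.
  have d3 : is_diff (F (push_coord ((q0, w0'), t0))) (fun w : 'cV[R]_n.+1 => w 0 0 : R)
     (fun w => w 0 0).
    exact: is_diff_linear_cV.
  have [d4 d5] := @is_diff_comp _ _ _ _ (fun z => F (push_coord z)) _ _ _ _ dFp d3.
  rewrite deriveE // d5 /= dF /=.
  have -> : (0 : 'I_n.+1) = lshift n (0 : 'I_1) by exact: val_inj.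
  by rewrite (@col_mxEu R 1 n 1) mxE eqxx.
have f0 : f ((q0, w0'), t0) = 0 by rewrite /f push0 F0 mxE.
have [|tau [stau tau0 Htau]] := implicit_scalar sf f0; first by rewrite Df oner_neq0.
(* The remaining equations, with the solved coordinate substituted. *)
pose F' z := @dsubmx R 1 n 1 (F (push_coord (z, tau z))).
have sp : smooth_at (fun z : Q * 'cV[R]_n => (z, tau z)) (q0, w0').
  by apply: smooth_at_pair => //; exact: smooth_at_id.
have lind : linear (@dsubmx R 1 n 1) by move=> c x y; rewrite linearP.
have sF' : smooth_at F' (q0, w0').
  apply: (smooth_at_linear_cV (L := @dsubmx R 1 n 1)) => //.
  by apply: (smooth_at_comp (g := fun z => F (push_coord z))) => //; rewrite tau0.
have F'0 : F' (q0, w0') = 0.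
  by rewrite /F' tau0 push0 F0; apply/matrixP => i j; rewrite !mxE.
have dF' w : 'd F' (q0, w0') (0, w) = w.
  have d1 : is_diff (q0, w0') (fun z => (z, tau z)) (fun v => (v, 'd tau (q0, w0') v)).
    exact: (is_diff_pair (is_diff_id _) (differentiableP (smooth_at_differentiable stau))).
  have dFp' := dFp; rewrite -tau0 in dFp'.
  have d2 := @is_diff_comp _ _ _ _ _ _ _ _ _ d1 dFp'.
  have d3 := is_diff_linear_cV (F (push_coord ((q0, w0'), tau (q0, w0')))) lind.
  have [_ ->] := @is_diff_comp _ _ _ _ _ _ _ _ _ d2 d3.
  by rewrite /= /push_coord /= dF (@col_mxKd R 1 n 1).
have [g' [sg' g'0 Hg']] := IH _ F' q0 w0' sF' F'0 dF'.
pose G q := push_coord ((q, g' q), tau (q, g' q)).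
have sq : smooth_at (fun q : Q => (q, g' q)) q0.
  by apply: smooth_at_pair => //; exact: smooth_at_id.
exists (fun q => (G q).2); split.
- apply: smooth_at_snd; apply: smooth_at_comp; last exact: push_coord_smooth.
  apply: smooth_at_pair => //.
  by apply: (smooth_at_comp (f := fun q : Q => (q, g' q))) => //; rewrite g'0.
- by rewrite /G g'0 tau0 push0.
have c1 : smooth_at (fun z : Q * 'cV[R]_n.+1 => (z.1, @dsubmx R 1 n 1 z.2)) (q0, w0).
  apply: smooth_at_pair; first by apply: smooth_at_fst; exact: smooth_at_id.
  by apply: smooth_at_linear_cV => //; apply: smooth_at_snd; exact: smooth_at_id.
have c2 : smooth_at (fun z : Q * 'cV[R]_n.+1 => ((z.1, @dsubmx R 1 n 1 z.2), z.2 0 0 : R)) (q0, w0).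
  by apply: smooth_at_pair => //; apply: smooth_at_coord; apply: smooth_at_snd; exact: smooth_at_id.
have N1 : \forall z \near (q0, w0), F' (z.1, @dsubmx R 1 n 1 z.2) = 0 <->
    @dsubmx R 1 n 1 z.2 = g' z.1 by exact: (smooth_at_continuous c1 Hg').
have N2 : \forall z \near (q0, w0), f (z.1, @dsubmx R 1 n 1 z.2, z.2 0 0) = 0 <->
    z.2 0 0 = tau (z.1, @dsubmx R 1 n 1 z.2) by exact: (smooth_at_continuous c2 Htau).
apply: filterS2 N1 N2 => -[q w] /= N1 N2.
have Fw : F (q, w) = F (push_coord (q, @dsubmx R 1 n 1 w, w 0 0)).
  by rewrite /push_coord /= pushK.
split=> [Fz|].
  have ft : w 0 0 = tau (q, @dsubmx R 1 n 1 w) by apply/N2; rewrite /f -Fw Fz mxE.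
  have fd : @dsubmx R 1 n 1 w = g' q.
    by apply/N1; rewrite /F' -ft -Fw Fz; apply/matrixP => i j; rewrite !mxE.
  by rewrite -fd -ft pushK.
move=> wE.
have e1 : @dsubmx R 1 n 1 w = g' q by rewrite wE /= (@col_mxKd R 1 n 1).
have e2 : w 0 0 = tau (q, @dsubmx R 1 n 1 w).
  rewrite e1 wE /=; have -> : (0 : 'I_n.+1) = lshift n (0 : 'I_1) by exact: val_inj.
  by rewrite (@col_mxEu R 1 n 1) mxE eqxx.
have d0 : @dsubmx R 1 n 1 (F (q, w)) = 0 by rewrite Fw e2; exact/N1.
have u0 : F (q, w) 0 0 = 0 by rewrite Fw; exact/N2.
by rewrite -(pushK (F (q, w))) d0 u0 raddf0; exact: (@col_mx0 R 1 n 1).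
Qed.

Lemma derive_section (Q W V : normedModType R) (F : Q * W -> V) (q : Q) (w v : W) :
  differentiable F (q, w) -> 'D_v (fun w => F (q, w)) w = 'd F (q, w) (0, v).
Proof.
move=> dF.
have H : is_diff w (F \o (fun s : W => (q, s))) ('d F (q, w) \o (fun s => (0, s))).
  by apply: is_diff_comp; apply: differentiableP.
by case: H => H1 H2; rewrite deriveE // H2.
Qed.

Lemma injective_unitmx n (M : 'M[R]_n) :
  (forall w : 'cV[R]_n, M *m w = 0 -> w = 0) -> M \in unitmx.
Proof.
move=> H; rewrite -unitmx_tr -row_free_unit -kermx_eq0; apply/eqP/row_matrixP => i.
rewrite row0 -[row i _]trmxK [(row _ _)^T]H ?trmx0 //.
by apply: trmx_inj; rewrite trmx_mul trmxK -row_mul mulmx_ker row0 trmx0.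
Qed.

(** Composing with the inverse of the partial differential reduces to the case
    where it is the identity. *)
Lemma implicit_cV n (Q : normedModType R) (F : Q * 'cV[R]_n -> 'cV[R]_n)
    (q0 : Q) (w0 : 'cV[R]_n) :
  smooth_at F (q0, w0) -> F (q0, w0) = 0 ->
  (forall w, 'D_w (fun w => F (q0, w)) w0 = 0 -> w = 0) ->
  exists g : Q -> 'cV[R]_n, [/\ smooth_at g q0, g q0 = w0 &
    \forall z \near (q0, w0), F z = 0 <-> z.2 = g z.1].
Proof.
move=> sF F0 dF; have dif := smooth_at_differentiable sF.
pose D w := 'D_w (fun w => F (q0, w)) w0.
have DE w : D w = 'd F (q0, w0) (0, w) by exact: derive_section.
have linD : linear D.
  move=> c x y; rewrite !DE -linearPZ; congr ('d F _ _).
  by apply/pair_equal_spec; split; rewrite /= ?scaler0 ?addr0.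
have [M MD] := linear_cV_mx linD.
have uM : M \in unitmx by apply: injective_unitmx => w; rewrite MD => /dF.
have linM : linear (mulmx (invmx M) : 'cV[R]_n -> 'cV[R]_n).
  by move=> c x y; rewrite linearP.
have [|||g [g1 g2 g3]] := @implicit_cV_id n Q (fun z => invmx M *m F z) q0 w0.
- exact: smooth_at_linear_cV.
- by rewrite F0 mulmx0.
- move=> w.
  have dL := is_diff_linear_cV (F (q0, w0)) linM.
  have [_ ->] := @is_diff_comp _ _ _ _ _ _ _ _ _ (differentiableP dif) dL.
  by rewrite /= -DE -MD mulKmx.
exists g; split=> //; apply: filterS g3 => z <-; split=> [->|]; first by rewrite mulmx0.
by move=> /(congr1 (mulmx M)); rewrite mulKVmx // mulmx0.
Qed.

End VectorImplicitFunction.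

(** * Division by the variable *)

Section Division.
Context {R : realType}.
Implicit Types (f g phi P E : R -> R).

Lemma is_derive_is_diff f (x l : R) : is_derive x 1 f l -> is_diff x f (fun y => y * l).
Proof.
move=> [d dl]; have d' := d; move/derivable1_diffP in d'; apply: DiffDef => //.
by rewrite diff1E //; apply/funext => y; rewrite derive1E dl.
Qed.

(** The mean value theorem integrates a bound on the derivative, which gains one
    power of [z]. *)
Lemma primitive_small E (eta : R -> R) (e : R) m : 0 <= e ->
  (forall z : R, is_derive z 1 E (eta z)) -> E 0 = 0 ->
  (\forall z \near (0 : R), `|eta z| <= e * `|z| ^+ m) ->
  \forall z \near (0 : R), `|E z| <= e * `|z| ^+ m.+1.
Proof.
move=> e0 dE E0 /nbhs_ballP[d /= d0 Hd]; apply/nbhs_ballP; exists d => //= z.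
rewrite -ball_normE /= sub0r normrN => zd.
have cE a b : {within `[a, b], continuous E}.
  apply: derivable_within_continuous => x _; by have [] := dE x.
have [c cz Ec] : exists2 c, `|c| <= `|z| & `|E z| = `|eta c| * `|z|.
  case: (leP 0 z) => z0.
    have [c Hc] := MVT_segment z0 (fun x _ => dE x) (cE 0 z).
    rewrite E0 !subr0 => ->; exists c; last by rewrite normrM.
    by move: Hc; rewrite in_itv /= => /andP[c0 cz]; rewrite !ger0_norm.
  have [c Hc] := MVT_segment (ltW z0) (fun x _ => dE x) (cE z 0).
  rewrite E0 !sub0r => Ec; exists c; last by rewrite -normrN Ec normrM normrN.
  move: Hc; rewrite in_itv /= => /andP[c0 cz].
  by rewrite !ler0_norm ?lerN2 // ltW.
rewrite Ec exprSr mulrA; apply: ler_wpM2r => //.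
apply: le_trans (Hd c _) _.
  by rewrite -ball_normE /= sub0r normrN (le_lt_trans cz).
by apply: ler_wpM2l => //; rewrite lerXn2r ?nnegrE.
Qed.

Lemma is_derive_exp (n : nat) (x : R) :
  is_derive x 1 (fun z : R => z ^+ n.+1) (n.+1%:R * x ^+ n).
Proof.
apply: DeriveDef; first exact: exprn_derivable.
by rewrite exp_derive [LHS]mulr1.
Qed.

Lemma frechet_C_derive1 k f : frechet_C k.+1 f setT -> frechet_C k (f^`()%classic) setT.
Proof.
move=> [df Hf].
apply: (@frechet_C_eq _ k _ _ ((fun z : R * R => 'd f (z.1) (z.2)) \o (fun x => (x, 1)))).
- exact: openT.
- by move=> x _ /=; rewrite derive1E deriveE //; exact: df.
apply: (frechet_C_comp (B := setT `*` setT)) Hf => //; first exact: openT.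
  exact: open_prodT openT.
apply: frechet_C_pair; [exact: openT| |exact: frechet_C_cst openT].
exact: frechet_C_id openT.
Qed.

Lemma near_neq0 (z : R) : z != 0 -> \forall y \near z, (y == 0) = false.
Proof.
move=> z0; have := open_nbhs_nbhs (conj (@open_neq R 0) z0).
by apply: filterS => y /= /negbTE.
Qed.

(** When [P] is the primitive of [s ^ n * phi s] that vanishes at [0], this is the
    integral of [t ^ n * phi (t * z)] over [t] in the unit interval. *)
Definition mean_quot n P phi (z : R) : R :=
  if z == 0 then phi 0 / n.+1%:R else P z / z ^+ n.+1.

(** Differentiation under the integral sign produces the same integral for the
    derivative of [phi] and the exponent [n + 1], whose primitive [Q] comes from
    an integration by parts; smoothness follows by induction on the order. *)
Lemma mean_quot_smooth k n P phi :
  (forall z : R, is_derive z 1 P (z ^+ n * phi z)) -> P 0 = 0 ->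
  frechet_C k phi setT -> frechet_C k (mean_quot n P phi) setT.
Proof.
elim: k n P phi => [|k IH] n P phi dP P0 Hphi.
  have phic (z : R) : {for z, continuous phi} by exact: Hphi.
  move=> z _; have [->|z0] := eqVneq z 0; last first.
    have : {for z, continuous (fun z => P z * (z ^+ n.+1)^-1)}.
      apply: differentiable_continuous; apply/derivable1_diffP.
      apply: derivableM; first by have [] := dP z.
      apply: derivableV; first by rewrite expf_neq0.
      exact: exprn_derivable.
    rewrite /prop_for /continuous_at {2}/mean_quot (negPf z0).
    apply: cvg_trans; apply: near_eq_cvg.
    by apply: filterS (near_neq0 z0) => y y0; rewrite /mean_quot y0.
  apply/cvgrPdist_le => e e0.
  pose E z := P z - phi 0 / n.+1%:R * z ^+ n.+1.
  have dE (y : R) : is_derive y 1 E (y ^+ n * (phi y - phi 0)).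
    have h1 := dP y; have h2 := is_derive_exp n y.
    have -> : E = P - (phi 0 / n.+1%:R) *: (fun z : R => z ^+ n.+1) by [].
    apply: is_derive_eq; rewrite /GRing.scale /=; field.
    by rewrite nat1r pnatr_eq0.
  have : \forall y \near (0 : R), `|E y| <= e * `|y| ^+ n.+1.
    apply: (primitive_small (ltW e0) dE).
      by rewrite /E P0 expr0n /= mulr0 subr0.
    have : \forall y \near (0 : R), `|phi 0 - phi y| <= e.
      by have /cvgrPdist_le := phic 0; apply.
    apply: filterS => y Hy; rewrite normrM normrX mulrC ler_wpM2r ?exprn_ge0 //.
    by rewrite distrC.
  apply: filterS => y; rewrite /mean_quot eqxx; case: ifPn => [_ _|y0 Ey].
    by rewrite subrr normr0 ltW.
  have -> : phi 0 / n.+1%:R - P y / y ^+ n.+1 = - (E y / y ^+ n.+1).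
    by rewrite /E mulrBl mulfK ?expf_neq0 // opprB.
  by rewrite normrN normrM normfV normrX ler_pdivrMr // exprn_gt0 // normr_gt0.
have dphi (z : R) : is_derive z 1 phi (phi^`()%classic z).
  rewrite derive1E; apply: derivableP; apply/derivable1_diffP; exact: Hphi.1.
pose Q z := z ^+ n.+1 * phi z - n.+1%:R * P z.
have dQ (z : R) : is_derive z 1 Q (z ^+ n.+1 * phi^`()%classic z).
  have h1 := dP z; have h2 := is_derive_exp n z; have h3 := dphi z.
  have -> : Q = (fun z : R => z ^+ n.+1) * phi - n.+1%:R *: P by [].
  apply: is_derive_eq; rewrite /GRing.scale /= exprS; ring.
have Q0 : Q 0 = 0 by rewrite /Q P0 expr0n /= mul0r mulr0 subr0.
apply: (frechet_C_is_diff (df := fun x y : R => y *: mean_quot n.+1 Q (phi^`()%classic) x) openT).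
  move=> z _; have [->|z0] := eqVneq z 0; last first.
    apply: is_derive_is_diff.
    have D : is_derive z 1 (fun z => P z * (z ^+ n.+1)^-1) (mean_quot n.+1 Q (phi^`()%classic) z).
      have zn0 : z ^+ n.+1 != 0 by rewrite expf_neq0.
      have h1 := dP z; have h2 := is_derive_exp n z.
      have h3 : is_derive z 1 (fun z : R => (z ^+ n.+1)^-1)
           (- (z ^+ n.+1) ^- 2 *: (n.+1%:R * z ^+ n)).
        have [h4 h5] := h2; apply: DeriveDef; first exact: derivableV.
        by rewrite deriveV // h5.
      have -> : (fun z => P z * (z ^+ n.+1)^-1) = P * (fun z : R => (z ^+ n.+1)^-1) by [].
      apply: is_derive_eq; rewrite /mean_quot (negPf z0) /Q /GRing.scale /= !exprS.
      by field; rewrite expf_neq0.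
    apply: near_eq_is_derive D.
    by apply: filterS (near_neq0 z0) => y y0; rewrite /mean_quot y0.
  rewrite {2}/mean_quot eqxx; set l := _ / _.
  have lin : linear (fun y : R => y *: l).
    by move=> c x y; rewrite /GRing.scale /=; ring.
  pose L : {linear R -> R} := HB.pack (fun y : R => y *: l) (GRing.isLinear.Build _ _ _ _ _ lin).
  apply: (@is_diff_remainder _ _ _ _ _ L); first exact: scalel_continuous.
  move=> e e0.
  (* At [0] the quotient is compared with its first-order expansion through the
     remainder [E], whose derivative is [y ^ n] times the remainder of [phi]. *)
  pose E z := P z - phi 0 / n.+1%:R * z ^+ n.+1 - l * z ^+ n.+2.
  have dE (y : R) : is_derive y 1 E (y ^+ n * (phi y - phi 0 - phi^`()%classic 0 * y)).
    have h1 := dP y; have h2 := is_derive_exp n y; have h3 := is_derive_exp n.+1 y.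
    have -> : E = P - (phi 0 / n.+1%:R) *: (fun z : R => z ^+ n.+1) - l *: (fun z : R => z ^+ n.+2) by [].
    apply: is_derive_eq; rewrite /GRing.scale /= /l !exprS; field.
    by rewrite !nat1r -?natrD ?pnatr_eq0.
  have : \forall y \near (0 : R), `|E y| <= e * `|y| ^+ n.+2.
    apply: (primitive_small (ltW e0) dE).
      by rewrite /E P0 !expr0n /= !mulr0 !subr0.
    have := diff_remainder (Hphi.1 0 I) e0.
    apply: filterS => y; rewrite subr0 diff1E; last exact: Hphi.1.
    rewrite /GRing.scale /= mulrC => Hy.
    by rewrite normrM normrX mulrC exprSr mulrA mulrAC ler_wpM2r ?exprn_ge0 // [_ * y]mulrC.
  apply: filterS => y; rewrite subr0 /L /= /mean_quot eqxx.
  case: ifPn => [/eqP -> _|y0 Ey]; first by rewrite subrr scale0r subr0 normr0 mulr0.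
  have yn : y ^+ n.+1 != 0 by rewrite expf_neq0.
  have -> : P y / y ^+ n.+1 - phi 0 / n.+1%:R - y *: l = E y / y ^+ n.+1.
    by rewrite /E !mulrBl mulfK // [y ^+ n.+2]exprS mulrA mulfK // [y *: l]mulrC.
  rewrite normrM normfV normrX ler_pdivrMr ?exprn_gt0 ?normr_gt0 //.
  by rewrite -mulrA -exprS.
have oT := open_prodT (@openT R).
apply: frechet_C_scale => //.
  exact: frechet_C_snd.
apply: (frechet_C_comp (f := fst) (B := setT)) => //; first exact: openT.
  exact: frechet_C_fst.
by apply: IH => //; exact: frechet_C_derive1.
Qed.

(** Hadamard's lemma on the line. *)
Lemma divide_by_var f : (forall k, frechet_C k f setT) -> f 0 = 0 ->
  exists2 g : R -> R, forall k, frechet_C k g setT & forall z, f z = z * g z.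
Proof.
move=> Hf f0; exists (mean_quot 0 f (f^`()%classic)) => [k|z]; last first.
  rewrite /mean_quot; case: eqVneq => [->|z0]; first by rewrite f0 mul0r.
  by rewrite expr1 mulrC divfK.
apply: mean_quot_smooth => //; last exact: frechet_C_derive1.
move=> z; rewrite expr0 mul1r derive1E; apply: derivableP.
by apply/derivable1_diffP; apply: (Hf 1%N).1.
Qed.

End Division.

(** * The cubic expansion of a sigmoid *)

Section CubicExpansion.
Context {R : realType}.
Implicit Types (S f g : R -> R).

Lemma frechet_C_is_derive f : (forall k, frechet_C k f setT) ->
  forall z : R, is_derive z 1 f (f^`()%classic z).
Proof.
move=> H z; rewrite derive1E; apply: derivableP; apply/derivable1_diffP.
exact: (H 1%N).1.
Qed.

(** The derivative of [c0 + c1 * z + z ^ m.+1 * g z] has again this shape with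
    [m] lowered by one, so that derivatives at [0] can be read off repeatedly. *)
Lemma derive1_taylor (c0 c1 : R) m g : (forall k, frechet_C k g setT) ->
  (fun z => c0 + c1 * z + z ^+ m.+1 * g z)^`()%classic =
  fun z => c1 + z ^+ m * (m.+1%:R * g z + z * g^`()%classic z).
Proof.
move=> Hg; apply/funext => z; rewrite derive1E.
have h1 := frechet_C_is_derive Hg z; have h2 := is_derive_exp m z.
have D : is_derive z 1 (fun z => c0 + c1 * z + z ^+ m.+1 * g z)
    (c1 + z ^+ m * (m.+1%:R * g z + z * g^`()%classic z)).
  have -> : (fun z => c0 + c1 * z + z ^+ m.+1 * g z) =
    cst c0 + c1 *: (id : R -> R) + (fun z : R => z ^+ m.+1) * g by [].
  have h3 := @is_deriveM _ _ _ _ z 1 _ _ h2 h1.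
  have h4 := @is_deriveZ _ _ _ id c1 z 1 _ (is_derive_id z 1).
  have h5 := is_deriveD (is_derive_cst c0 z 1) h4.
  apply: (is_derive_eq (is_deriveD h5 h3)).
  move: (g z) (g^`()%classic z) => u u'.
  rewrite /GRing.scale /= exprS; ring.
by have [_ ->] := D.
Qed.

Lemma frechet_C_taylor_step m g : (forall k, frechet_C k g setT) ->
  forall k, frechet_C k (fun z => m.+1%:R * g z + z * g^`()%classic z) setT.
Proof.
move=> Hg k; have oT := @openT R.
apply: frechet_C_add => //; apply: frechet_C_scale => //.
- exact: frechet_C_cst.
- exact: frechet_C_id.
- by apply: frechet_C_derive1; exact: Hg.
Qed.

(** The sign condition on the second derivative forces the quadratic coefficient
    to vanish and the cubic coefficient to be nonpositive. *)
Lemma sigmoid_cubic S : sigmoid S -> S^`(3)%classic 0 != 0 ->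
  exists r : R -> R, [/\ forall k, frechet_C k r setT,
    forall z, S z = z + z ^+ 3 * r z & r 0 < 0].
Proof.
move=> [dS _ [S0 S1] S2] S3.
have smS := frechet_C_derive1n dS.
have addc g (c : R) : (forall k, frechet_C k g setT) ->
    forall k, frechet_C k (fun z => g z + c) setT.
  by move=> Hg k; apply: frechet_C_add => //; [exact: openT|exact: frechet_C_cst openT].
have [g1 sm1 E1] := divide_by_var smS S0.
have S'E1 : S^`()%classic = fun z => 0 + z ^+ 0 * (1%:R * g1 z + z * g1^`()%classic z).
  rewrite -(derive1_taylor 0 0 0 sm1); congr derive1; apply/funext => z.
  by rewrite E1 expr1; ring.
have g10 : g1 0 = 1 by move: S1; rewrite S'E1 => <-; ring.
have [g2 sm2 E2] : exists2 g : R -> R, forall k, frechet_C k g setT &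
    forall z, g1 z + -1 = z * g z.
  by apply: divide_by_var; [exact: addc|rewrite g10 subrr].
have S'E2 : S^`()%classic = fun z => 1 + z ^+ 1 * (2%:R * g2 z + z * g2^`()%classic z).
  rewrite -(derive1_taylor 0 1 1 sm2); congr derive1; apply/funext => z.
  by rewrite E1 -[g1 z](subrK 1) E2; ring.
have sm2' := frechet_C_taylor_step 1 sm2.
have S''E2 : S^`(2)%classic = fun z => 0 + z ^+ 0 *
    (1%:R * (2%:R * g2 z + z * g2^`()%classic z) +
     z * (fun z => 2%:R * g2 z + z * g2^`()%classic z)^`()%classic z).
  rewrite -(derive1_taylor 1 0 0 sm2') derive1nS derive1n1 S'E2.
  by congr derive1; apply/funext => z; rewrite expr1; ring.
have S20 : S^`(2)%classic 0 = 0.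
  by apply/eqP; rewrite -sgr_eq0 S2 sgr0 oppr0.
have g20 : g2 0 = 0.
  have : 2%:R * g2 0 = 0 by rewrite -[RHS]S20 S''E2; ring.
  by move/eqP; rewrite mulf_eq0 pnatr_eq0 /= => /eqP.
have [g3 sm3 E3] := divide_by_var sm2 g20.
have SE z : S z = z + z ^+ 3 * g3 z.
  by rewrite E1 -[g1 z](subrK 1) E2 E3; ring.
have [q [q0E smq S''E]] : exists q : R -> R, [/\ q 0 = 6 * g3 0,
    forall j, frechet_C j q setT & S^`(2)%classic = fun z => 0 + z ^+ 1 * q z].
  pose k z := 3%:R * g3 z + z * g3^`()%classic z.
  pose q z := 2%:R * k z + z * k^`()%classic z.
  have smk : forall j, frechet_C j k setT by exact: (frechet_C_taylor_step 2 sm3).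
  have smq : forall j, frechet_C j q setT by exact: (frechet_C_taylor_step 1 smk).
  have S'E : S^`()%classic = fun z => 1 + z ^+ 2 * k z.
    rewrite -(derive1_taylor 0 1 2 sm3); congr derive1; apply/funext => z.
    by rewrite SE; ring.
  have S''E : S^`(2)%classic = fun z => 0 + z ^+ 1 * q z.
    rewrite -(derive1_taylor 1 0 1 smk) derive1nS derive1n1 S'E.
    by congr derive1; apply/funext => z; ring.
  exists q; split=> //.
  by rewrite /q mul0r addr0 /k mul0r addr0; ring.
have S'''0 : S^`(3)%classic 0 = 6 * g3 0.
  rewrite derive1nS S''E.
  have -> : (fun z => 0 + z ^+ 1 * q z) = fun z => 0 + 0 * z + z ^+ 1 * q z.
    by apply/funext => z; ring.
  by rewrite (derive1_taylor 0 0 0 smq) expr0 mul0r addr0 add0r mul1r mul1r.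
exists g3; split=> //.
have g3n : g3 0 != 0 by apply: contraNneq S3 => g30; rewrite S'''0 g30 mulr0.
rewrite lt_neqAle g3n /= leNgt; apply/negP => g30.
have q0 : 0 < q 0 by rewrite q0E mulr_gt0.
have qc : {for 0, continuous q} by exact: (smq 0%N 0 I).
have : \forall z \near (0 : R), 0 < q z by exact: (cvgr_gt _ qc _ q0).
move=> /nbhs_ballP[e /= e0 He].
have e2 : 0 < e / 2 by rewrite divr_gt0.
have : 0 < S^`(2)%classic (e / 2).
  rewrite S''E add0r expr1 mulr_gt0 //; apply: He.
  rewrite -ball_normE /= sub0r normrN gtr0_norm //.
  by rewrite ltr_pdivrMr // ltr_pMr // ltr1n.
by rewrite -sgr_gt0 S2 gtr0_sg // oppr_gt0 ltr10.
Qed.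

End CubicExpansion.

(** * Simple eigenvalues of symmetric matrices *)

Section SimpleEigenvalue.

(** In a basis that starts with eigenvectors, the rows of the characteristic
    matrix that belong to them are multiples of ['X - a]; these factors come out
    of the determinant. *)
Lemma geom_mult_le (F : fieldType) n (A : 'M[F]_n) (a : F) :
  ('X - a%:P) ^+ \rank (eigenspace A a) %| char_poly A.
Proof.
set K := eigenspace A a; set r := \rank K.
pose E := row_ebase K.
have uE : E \in unitmx by exact: row_ebase_unit.
have rn : (r <= n)%N by exact: rank_leq_row.
have KA : (pid_mx r : 'M[F]_n) *m E *m A = a *: ((pid_mx r : 'M[F]_n) *m E).
  have : (pid_mx r : 'M[F]_n) *m E = invmx (col_ebase K) *m K.
    by rewrite -{2}(mulmx_ebase K) -mulmxA mulKmx // col_ebase_unit.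
  move=> ->; rewrite -mulmxA scalemxAr; congr (_ *m _).
  by apply/eigenspaceP; exact: submx_refl.
pose c : 'rV[{poly F}]_n := \row_i (if (i < r)%N then 'X - a%:P else 1).
pose D := diag_mx c.
pose M := \matrix_(i, j) if (i < r)%N then (E i j)%:P else
   (map_mx polyC E *m char_poly_mx A) i j.
have DM : map_mx polyC E *m char_poly_mx A = D *m M.
  apply/matrixP => i j; rewrite mul_diag_mx !mxE; case: ifP => ir; last first.
    by rewrite mul1r.
  have := congr1 (fun B : 'M[F]_n => B i j) KA.
  have pidE (B : 'M[F]_n) k : ((pid_mx r : 'M[F]_n) *m B) i k = B i k.
    rewrite mxE (bigD1 i) //= big1 ?addr0 => [|l li]; first by rewrite mxE eqxx ir mul1r.
    by rewrite mxE eq_sym (inj_eq val_inj) (negPf li) mul0r.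
  rewrite /= -mulmxA pidE [RHS]mxE pidE [LHS]mxE => EA.
  transitivity (\sum_l ((E i l)%:P * ('X *+ (l == j)) - (E i l * A l j)%:P)).
    by apply: eq_bigr => l _; rewrite !mxE mulrBr polyCM.
  rewrite sumrB -raddf_sum EA (bigD1 j) //= big1 ?addr0 => [|l lj]; last first.
    by rewrite (negPf lj) mulr0n mulr0.
  by rewrite eqxx mulr1n mulrBl polyCM mulrC.
have := congr1 determinant DM; rewrite !det_mulmx det_map_mx det_diag.
have -> : \prod_(i < n) c 0 i = ('X - a%:P) ^+ r.
  transitivity (\prod_(i < n) (if (i < r)%N then 'X - a%:P else 1 : {poly F})).
    by apply: eq_bigr => i _; rewrite mxE.
  rewrite -big_mkcond /= prodr_const; congr (_ ^+ _).
  have wi : injective (widen_ord rn) by move=> x y /(congr1 val) /= /val_inj.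
  rewrite -[RHS](card_ord r) -(fintype.card_image wi); apply: eq_card => i.
  apply/idP/fintype.imageP => [ir|[k _ ->]]; last exact: (ltn_ord k).
  by exists (Ordinal ir) => //; exact: val_inj.
move=> eqd; have : ('X - a%:P) ^+ r %| (\det E)%:P * char_poly A.
  by rewrite eqd dvdp_mulIl.
by rewrite mul_polyC dvdpZr // -unitfE -unitmxE.
Qed.

Context {R : realType}.

Lemma dotvC n (x y : 'cV[R]_n) : dotv x y = dotv y x.
Proof. by apply: eq_bigr => i _; rewrite mulrC. Qed.

Lemma dotvDr n (x y z : 'cV[R]_n) : dotv x (y + z) = dotv x y + dotv x z.
Proof. by rewrite -big_split; apply: eq_bigr => i _; rewrite !mxE mulrDr. Qed.

Lemma dotvZr n c (x y : 'cV[R]_n) : dotv x (c *: y) = c * dotv x y.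
Proof. by rewrite mulr_sumr; apply: eq_bigr => i _; rewrite !mxE mulrCA. Qed.

Lemma dotv_linear n (x : 'cV[R]_n) : linear (dotv x).
Proof. by move=> c y z; rewrite dotvDr dotvZr. Qed.

Lemma dotvBr n (x y z : 'cV[R]_n) : dotv x (y - z) = dotv x y - dotv x z.
Proof. by rewrite -scaleN1r dotvDr dotvZr mulN1r. Qed.

Lemma dotv0 n (x : 'cV[R]_n) : dotv x 0 = 0.
Proof. by rewrite -(scale0r 0) dotvZr mul0r. Qed.

Lemma dotv_mulmx n (A : 'M[R]_n) (x y : 'cV[R]_n) :
  dotv x (A *m y) = dotv (A^T *m x) y.
Proof.
transitivity (\sum_i \sum_j x i 0 * A i j * y j 0).
  by apply: eq_bigr => i _; rewrite mxE mulr_sumr; apply: eq_bigr => j _; rewrite mulrA.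
rewrite exchange_big; apply: eq_bigr => j _; rewrite mxE mulr_suml.
by apply: eq_bigr => i _; rewrite mxE [x i 0 * _]mulrC.
Qed.

Lemma dotv_gt0 n (x : 'cV[R]_n) : x != 0 -> 0 < dotv x x.
Proof.
move=> x0; rewrite lt_neqAle sumr_ge0 ?andbT => [|i _]; last by rewrite -expr2 sqr_ge0.
rewrite eq_sym; apply: contraNneq x0 => /psumr_eq0P H.
apply/eqP/colP => i; rewrite mxE; apply/eqP; rewrite -sqrf_eq0 expr2 H // => j _.
by rewrite -expr2 sqr_ge0.
Qed.

(** Geometric multiplicity one puts [w] on the line of [v]. *)
Lemma simple_eigenvector n (A : 'M[R]_n) (a : R) (v w : 'cV[R]_n) :
  A^T = A -> mup a (char_poly A) = 1%N -> v != 0 ->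
  A *m v = a *: v -> A *m w = a *: w -> dotv v w = 0 -> w = 0.
Proof.
move=> As mu v0 Av Aw vw.
have eig (x : 'cV[R]_n) : A *m x = a *: x -> (x^T <= eigenspace A a)%MS.
  by move=> Ax; apply/eigenspaceP; rewrite -{1}As -trmx_mul Ax linearZ.
have p0 : char_poly A != 0 by rewrite monic_neq0 // char_poly_monic.
have r1 : (\rank (eigenspace A a) <= 1)%N by rewrite -mu mup_geq // geom_mult_le.
have rv : \rank v^T = 1%N by rewrite rank_rV -(inj_eq trmx_inj) trmxK trmx0 v0.
have Ev : (eigenspace A a <= v^T)%MS.
  have [le eq] := mxrank_leqif_sup (eig v Av).
  by rewrite -eq eqn_leq le /= rv.
have /sub_rVP[c wc] := submx_trans (eig w Aw) Ev.
have {}wc : w = c *: v by apply: trmx_inj; rewrite wc linearZ.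
move: vw; rewrite wc dotvZr => /eqP; rewrite mulf_eq0 (gt_eqF (dotv_gt0 v0)) orbF.
by move/eqP ->; rewrite scale0r.
Qed.

End SimpleEigenvalue.

(** * The scalar equation x (a (u - u0) + x^2 m) = 0 *)

Section CubicNormalForm.
Context {R : realType}.

Context (m : R * R -> R) (a u0 : R) (sm : smooth_at m (0, u0)).

(** The equation is solved for the parameter, in which it is linear to first
    order. *)
Lemma cubic_parameter : a != 0 -> exists U : R -> R, [/\ smooth_at U 0, U 0 = u0 &
  \forall z \near (0, u0), a * (z.2 - u0) + z.1 ^+ 2 * m z = 0 <-> z.2 = U z.1].
Proof.
move=> a0.
pose f (z : R * R) : R := a * (z.2 - u0) + z.1 ^+ 2 * m z.
have s1 : smooth_at (fun z : R * R => z.1) (0, u0).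
  by apply: smooth_at_fst; exact: smooth_at_id.
have s2 : smooth_at (fun z : R * R => z.2) (0, u0).
  by apply: smooth_at_snd; exact: smooth_at_id.
have sf : smooth_at f (0, u0).
  apply: smooth_at_add.
    apply: smooth_at_mul; first exact: smooth_at_cst.
    by apply: smooth_at_sub => //; exact: smooth_at_cst.
  by apply: smooth_at_mul => //; exact: smooth_at_exp.
have f0 : f (0, u0) = 0 by rewrite /f /= subrr; ring.
have Df : 'D_((0, 1) : R * R) f (0, u0) != 0.
  rewrite deriveE; last exact: smooth_at_differentiable.
  rewrite -derive_section; last exact: smooth_at_differentiable.
  have -> : (fun w => f (0, w)) = fun w : R => - (a * u0) + a * w + w ^+ 1 * 0.
    by apply/funext => w; rewrite /f /=; ring.
  rewrite -derive1E (derive1_taylor _ _ _ (g := fun=> 0)); last first.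
    by move=> k; exact: frechet_C_cst openT.
  by rewrite derive1_cst !mulr0 addr0 mulr0 addr0.
exact: implicit_scalar sf f0 Df.
Qed.

(** At a nontrivial zero the linear part equals [- x ^+ 2 * m], so both
    derivatives are governed by the sign of [m]. *)
Lemma cubic_stability (g : R -> R -> R) : m (0, u0) != 0 ->
  (\forall z \near (0, u0), g z.1 z.2 = z.1 * (a * (z.2 - u0) + z.1 ^+ 2 * m z)) ->
  \forall z \near ((0, u0) : R * R), z.1 != 0 -> g z.1 z.2 = 0 ->
    0 < (fun x => g x z.2)^`()%classic z.1 * m (0, u0) /\
    (fun x => g x z.2)^`()%classic 0 * m (0, u0) < 0.
Proof.
move=> m0 Hg.
have sD := smooth_at_derive ((1, 0) : R * R) sm.
have mm : 0 < m (0, u0) * m (0, u0) by rewrite -expr2 exprn_even_gt0.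
have n1 : \forall z \near ((0, u0) : R * R), 0 < m z * m (0, u0).
  have s : smooth_at (fun z => m z * m (0, u0)) (0, u0).
    by apply: smooth_at_mul => //; exact: smooth_at_cst.
  exact: (cvgr_gt _ (smooth_at_continuous s) _ mm).
have n2 : \forall z \near ((0, u0) : R * R),
    0 < (2 * m z + z.1 * 'D_((1, 0) : R * R) m z) * m (0, u0).
  have s : smooth_at (fun z : R * R => (2 * m z + z.1 * 'D_((1, 0) : R * R) m z) * m (0, u0)) (0, u0).
    apply: smooth_at_mul; last exact: smooth_at_cst.
    apply: smooth_at_add; first by apply: smooth_at_mul => //; exact: smooth_at_cst.
    by apply: smooth_at_mul => //; apply: smooth_at_fst; exact: smooth_at_id.
  apply: (cvgr_gt _ (smooth_at_continuous s) _ _).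
  by rewrite /= mul0r addr0 -mulrA mulr_gt0.
have n3 : \forall z \near ((0, u0) : R * R), smooth_at m z by exact: smooth_at_near.
have [d d0 Hd] := near_prod_bound (filterI (filterI n1 n2) (filterI n3 Hg)).
have : \forall z \near ((0, u0) : R * R), ball ((0, u0) : R * R) d z.
  exact: nbhsx_ballx.
apply: filterS => -[x u] [] /=; rewrite -!ball_normE /= sub0r normrN => xd ud x0 gxu.
rewrite distrC in ud.
have xd0 : `|x - 0| < d by rewrite subr0.
have der y : `|y| < d -> (fun x => g x u)^`()%classic y =
    a * (u - u0) + 3 * y ^+ 2 * m (y, u) + y ^+ 3 * 'D_((1, 0) : R * R) m (y, u).
  move=> yd; have yd0 : `|y - 0| < d by rewrite subr0.
  have [_ [smy _]] := Hd y u yd0 ud.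
  have dm := smooth_at_differentiable smy.
  have h1 : is_derive y 1 (fun x : R => m (x, u)) ('D_((1, 0) : R * R) m (y, u)).
    have H : is_diff y (m \o (fun s : R => (s, u))) ('d m (y, u) \o (fun s => (s, 0))).
      by apply: is_diff_comp; apply: differentiableP.
    case: H => H1 H2; apply: DeriveDef; first exact: diff_derivable.
    by rewrite deriveE // H2 /= deriveE.
  have h2 := is_derive_exp 2 y.
  have h3 := @is_deriveM _ _ _ _ y 1 _ _ h2 h1.
  have h4 := @is_deriveZ _ _ _ id (a * (u - u0)) y 1 _ (is_derive_id y 1).
  have h5 := is_deriveD h4 h3.
  rewrite derive1E.
  have h6 : is_derive y 1 (fun x => g x u)
     (a * (u - u0) + 3 * y ^+ 2 * m (y, u) + y ^+ 3 * 'D_((1, 0) : R * R) m (y, u)).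
    apply: near_eq_is_derive (is_derive_eq h5 _); last first.
      by move: (m (y, u)) ('D_((1, 0) : R * R) m (y, u)) => M M'; rewrite /GRing.scale /=; ring.
    have : \forall y' \near y, `|y'| < d.
      by have /cvgr_lt := @norm_continuous _ R y; apply.
    apply: filterS => y' y'd; have y'd0 : `|y' - 0| < d by rewrite subr0.
    have [_ [_ /= ->]] := Hd y' u y'd0 ud.
    transitivity (a * (u - u0) * y' + y' ^+ 3 * m (y', u)); [by []|ring].
  by have [_ ->] := h6.
have [[/= m1 m2] [_ /= gE]] := Hd x u xd0 ud.
have A0 : a * (u - u0) = - (x ^+ 2 * m (x, u)).
  apply/eqP; rewrite -addr_eq0; move/eqP: gxu; rewrite gE mulf_eq0 (negPf x0) /=.
  by [].
have x2 : 0 < x ^+ 2 by rewrite exprn_even_gt0.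
rewrite !der ?normr0 // A0; split.
  have -> : (- (x ^+ 2 * m (x, u)) + 3 * x ^+ 2 * m (x, u) +
      x ^+ 3 * 'D_((1, 0) : R * R) m (x, u)) * m (0, u0) =
     x ^+ 2 * ((2 * m (x, u) + x * 'D_((1, 0) : R * R) m (x, u)) * m (0, u0)).
    by move: ('D_((1, 0) : R * R) m (x, u)) => M'; ring.
  exact: mulr_gt0.
rewrite expr0n /= mulr0 mul0r addr0 expr0n /= mul0r addr0 mulNr oppr_lt0 -mulrA.
exact: mulr_gt0.
Qed.

Context (e : R) (a0 : a != 0) (e1 : e = 1 \/ e = -1) (eam : 0 < e * a * m (0, u0)).

Let m0 : m (0, u0) != 0.
Proof. by apply: contraTneq eam => ->; rewrite mulr0 ltxx. Qed.

Let ee : e * e = 1.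
Proof. by case: e1 => ->; ring. Qed.

(** The rescaling [X = x * rho] of the state variable that turns the cubic
    coefficient [m] into a constant. *)
Lemma cubic_rescaling : exists rho : R * R -> R, [/\ smooth_at rho (0, 0),
  0 < rho (0, 0) &
  \forall z \near ((0, 0), rho (0, 0)), z.2 ^+ 2 * m (z.1.1 * z.2, u0 + z.1.2) = e * a <->
     z.2 = rho z.1].
Proof.
pose rho0 := Num.sqrt (e * a / m (0, u0)).
have cm0 : 0 < e * a / m (0, u0).
  have -> : e * a / m (0, u0) = e * a * m (0, u0) / (m (0, u0)) ^+ 2 by field.
  by rewrite divr_gt0 // exprn_even_gt0.
have rho00 : 0 < rho0 by rewrite sqrtr_gt0.
have rho02 : rho0 ^+ 2 * m (0, u0) = e * a by rewrite sqr_sqrtr ?ltW // divfK.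
pose f z : R := z.2 ^+ 2 * m (z.1.1 * z.2, u0 + z.1.2) - e * a.
have s1 : smooth_at (fun z : (R * R) * R => z.1) ((0, 0), rho0).
  by apply: smooth_at_fst; exact: smooth_at_id.
have s2 : smooth_at (fun z : (R * R) * R => z.2) ((0, 0), rho0).
  by apply: smooth_at_snd; exact: smooth_at_id.
have sf : smooth_at f ((0, 0), rho0).
  apply: smooth_at_sub; last exact: smooth_at_cst.
  apply: smooth_at_mul; first exact: smooth_at_exp.
  apply: (smooth_at_comp (g := m)).
    apply: smooth_at_pair.
      by apply: smooth_at_mul => //; exact: smooth_at_fst.
    by apply: smooth_at_add; [exact: smooth_at_cst|exact: smooth_at_snd].
  by rewrite /= mul0r addr0.
have f0 : f ((0, 0), rho0) = 0 by rewrite /f /= mul0r addr0 rho02 subrr.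
have Df : 'D_((0, 1) : (R * R) * R) f ((0, 0), rho0) != 0.
  rewrite deriveE; last exact: smooth_at_differentiable.
  rewrite -derive_section; last exact: smooth_at_differentiable.
  have -> : (fun w => f ((0, 0), w)) = fun w : R => - (e * a) + 0 * w + w ^+ 2 * m (0, u0).
    by apply/funext => w; rewrite /f /= mul0r addr0; ring.
  rewrite -derive1E (derive1_taylor _ _ _ (g := fun=> m (0, u0))); last first.
    by move=> k; exact: frechet_C_cst openT.
  rewrite derive1_cst mulr0 addr0 add0r; apply: mulf_neq0.
    by rewrite expf_neq0 // lt0r_neq0.
  by apply: mulf_neq0; rewrite ?pnatr_eq0.
have [rho [srho rho0E H]] := implicit_scalar sf f0 Df.
exists rho; rewrite rho0E; split=> //; apply: filterS H => z <-.
by rewrite /f; split=> [->|/eqP]; rewrite ?subrr // subr_eq0 => /eqP.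
Qed.

(** With [X = x * rho] the bracket becomes [a * (q + e * x ^ 2)], and the factor
    [a * rho] in front is absorbed by [T] up to the sign of [a]. *)
Lemma cubic_normal_form (g : R -> R -> R) :
  (\forall z \near (0, u0), g z.1 z.2 = z.1 * (a * (z.2 - u0) + z.1 ^+ 2 * m z)) ->
  symmetric_pitchfork g 0 u0.
Proof.
move=> Hg; have [rho [srho rho0 Hrho]] := cubic_rescaling.
exists (Num.sg a), e; split=> //.
  by rewrite /Num.sg (negPf a0); case: ifP; [right|left].
have s1 : smooth_at (fun z : R * R => z.1) (0, 0).
  by apply: smooth_at_fst; exact: smooth_at_id.
have s2 : smooth_at (fun z : R * R => z.2) (0, 0).
  by apply: smooth_at_snd; exact: smooth_at_id.
have sX : smooth_at (fun z : R * R => z.1 * rho z) (0, 0) by exact: smooth_at_mul.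
have aga : 0 < Num.sg a / a.
  have -> : Num.sg a / a = `|a| / a ^+ 2 by rewrite normrEsg; field.
  by rewrite divr_gt0 ?normr_gt0 // exprn_even_gt0.
exists (fun z => Num.sg a / a / rho z), (fun z => z.1 * rho z), (fun q => u0 + q).
split.
- split.
  + apply: smooth_at_smooth_near; apply: smooth_at_mul; first exact: smooth_at_cst.
    by apply: smooth_at_inv => //; rewrite gt_eqF.
  + exact: smooth_at_smooth_near.
  + apply: smooth_at_smooth_near; apply: smooth_at_add; first exact: smooth_at_cst.
    exact: smooth_at_id.
- by rewrite mul0r addr0.
- split; first by rewrite divr_gt0.
    have -> : 'D_((1, 0) : R * R) (fun z : R * R => z.1 * rho z) (0, 0) = rho (0, 0).
      have d1 := smooth_at_differentiable s1; have d2 := smooth_at_differentiable srho.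
      rewrite (@deriveM _ _ (fun z : R * R => z.1) rho); try exact: diff_derivable.
      rewrite /= scale0r add0r [X in _ *: X](_ : _ = 1); first by rewrite [LHS]mulr1.
      rewrite deriveE // (@diff_lin _ _ _ fst) //.
      by move=> x; exact: cvg_fst.
    exact: rho0.
  have -> : (fun q : R => u0 + q) = fun q => u0 + 1 * q + q ^+ 1 * 0.
    by apply/funext => q; ring.
  rewrite (derive1_taylor _ _ _ (g := fun=> 0)); last first.
    by move=> k; exact: frechet_C_cst openT.
  by rewrite derive1_cst !mulr0 addr0 mulr0 addr0 ltr01.
have c1 : smooth_at (fun z : R * R => (z.1 * rho z, u0 + z.2)) (0, 0).
  by apply: smooth_at_pair => //; apply: smooth_at_add => //; exact: smooth_at_cst.
have c2 : smooth_at (fun z : R * R => (z, rho z)) (0, 0).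
  by apply: smooth_at_pair => //; exact: smooth_at_id.
have n1 : \forall z \near ((0, 0) : R * R), g (z.1 * rho z) (u0 + z.2) =
   (z.1 * rho z) * (a * ((u0 + z.2) - u0) + (z.1 * rho z) ^+ 2 * m (z.1 * rho z, u0 + z.2)).
  have E : ((0 : R) * rho (0, 0), u0 + 0) = (0, u0) by rewrite mul0r addr0.
  rewrite -E in Hg; exact: (smooth_at_continuous c1 Hg).
have n2 : \forall z \near ((0, 0) : R * R), rho z ^+ 2 * m (z.1 * rho z, u0 + z.2) = e * a.
  have : \forall z \near ((0, 0) : R * R), rho z ^+ 2 * m (z.1 * rho z, u0 + z.2) = e * a <->
    rho z = rho z by exact: (smooth_at_continuous c2 Hrho).
  by apply: filterS => z [_]; apply.
have n3 : \forall z \near ((0, 0) : R * R), 0 < rho z.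
  exact: (cvgr_gt _ (smooth_at_continuous srho) _ rho0).
apply: filterS3 n1 n2 n3 => z -> E rz.
have -> : (z.1 * rho z) ^+ 2 * m (z.1 * rho z, u0 + z.2) = z.1 ^+ 2 * (e * a).
  by rewrite -E; ring.
have rz0 : rho z != 0 by rewrite gt_eqF.
by field; rewrite rz0 a0.
Qed.

(** In the normal form coordinate [x] the nontrivial zeros at the parameter
    [u0 - e * t] satisfy [x ^ 2 = t], so the branches are the images of the two
    square roots of [t] under the rescaling.  On the other side, at [u0 + e * t],
    the two terms of the equation have the same sign. *)
Lemma cubic_branches : exists (xp xm : R -> R) (r d : R),
  [/\ 0 < r /\ 0 < d,
     forall t, 0 <= t < r -> {for t, continuous xp} /\ {for t, continuous xm},
     xp 0 = 0 /\ xm 0 = 0,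
     forall t, 0 < t < r -> [/\ xm t < 0 < xp t,
        forall x, x = xp t \/ x = xm t -> a * (- e * t) + x ^+ 2 * m (x, u0 - e * t) = 0 &
        forall x, `|x| < d -> a * (- e * t) + x ^+ 2 * m (x, u0 - e * t) = 0 ->
          x = xp t \/ x = xm t] &
     forall t x, 0 <= t < r -> `|x| < d -> x != 0 ->
       a * (e * t) + x ^+ 2 * m (x, u0 + e * t) != 0].
Proof.
have [rho [srho rho0 Hrho]] := cubic_rescaling.
have E0 : rho (0, 0) ^+ 2 * m (0, u0) = e * a.
  by have [_ /(_ erefl)] := nbhs_singleton Hrho; rewrite /= mul0r addr0.
have [d1 d10 H1] := near_prod_bound Hrho.
have n2 : \forall z \near ((0, 0) : R * R), smooth_at rho z by exact: smooth_at_near.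
have n2' : \forall z \near ((0, 0) : R * R), 0 < rho z.
  exact: (cvgr_gt _ (smooth_at_continuous srho) _ rho0).
have n2'' : \forall z \near ((0, 0) : R * R), rho z ^+ 2 * m (z.1 * rho z, u0 + z.2) = e * a.
  have c2 : smooth_at (fun z : R * R => (z, rho z)) (0, 0).
    by apply: smooth_at_pair => //; exact: smooth_at_id.
  have : \forall z \near ((0, 0) : R * R), rho z ^+ 2 * m (z.1 * rho z, u0 + z.2) = e * a <->
    rho z = rho z by exact: (smooth_at_continuous c2 Hrho).
  by apply: filterS => z [_]; apply.
have [d2 d20 H2] := near_prod_bound (filterI n2 (filterI n2' n2'')).
have n3 : \forall z \near ((0, u0) : R * R), 0 < e * a * m z.
  have s : smooth_at (fun z => e * a * m z) (0, u0).
    by apply: smooth_at_mul => //; exact: smooth_at_cst.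
  exact: (cvgr_gt _ (smooth_at_continuous s) _ eam).
have n4 : \forall z \near ((0, u0) : R * R), `|rho (0, 0) ^+ 2 - e * a / m z| < d1 * rho (0, 0).
  have s : smooth_at (fun z => e * a / m z) (0, u0).
    by apply: smooth_at_mul; [exact: smooth_at_cst|exact: smooth_at_inv].
  have := smooth_at_continuous s => /cvgrPdist_lt /(_ (d1 * rho (0, 0))) H.
  have -> : rho (0, 0) ^+ 2 = e * a / m (0, u0) by rewrite -E0 mulfK.
  by apply: H; exact: mulr_gt0.
have [d3 d30 H3] := near_prod_bound (filterI n3 n4).
pose d := Num.min d1 (Num.min d2 d3).
have d0 : 0 < d by rewrite !lt_min d10 d20 d30.
have [dd1 dd2 dd3] : [/\ d <= d1, d <= d2 & d <= d3].
  by rewrite /d !ge_min !lexx !orbT.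
(* The bound [d ^ 2] on [t] keeps the square root of [t] below [d]. *)
pose r := Num.min d (d ^+ 2).
have r0 : 0 < r by rewrite lt_min d0 exprn_gt0.
have et t : 0 <= t -> `|e * t| = t.
  by move=> t0; rewrite normrM (ger0_norm t0); case: e1 => ->; rewrite ?normrN normr1 mul1r.
have sq t : 0 <= t < r -> Num.sqrt t < d /\ t < d.
  move=> /andP[t0]; rewrite lt_min => /andP[td td2]; split=> //.
  by rewrite -(gtr0_norm d0) -sqrtr_sqr ltr_sqrt // exprn_gt0.
have B2 t (b : R) : 0 <= t < r -> b = 1 \/ b = -1 -> smooth_at rho (b * Num.sqrt t, - e * t) /\
    (0 < rho (b * Num.sqrt t, - e * t) /\ rho (b * Num.sqrt t, - e * t) ^+ 2 *
      m (b * Num.sqrt t * rho (b * Num.sqrt t, - e * t), u0 - e * t) = e * a).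
  move=> tr b1; have [s1 s2] := sq _ tr; have /andP[t0 _] := tr.
  have := H2 (b * Num.sqrt t) (- e * t); rewrite !subr0 /= mulNr; apply.
    rewrite normrM (ger0_norm (sqrtr_ge0 t)).
    by case: b1 => ->; rewrite ?normrN normr1 mul1r (lt_le_trans s1).
  by rewrite normrN et // (lt_le_trans s2).
(* The sign [b] selects the branch. *)
pose xb (b t : R) := b * Num.sqrt t * rho (b * Num.sqrt t, - e * t).
have cxb t b : 0 <= t < r -> b = 1 \/ b = -1 -> {for t, continuous (xb b)}.
  move=> tr b1; have [sr _] := B2 t b tr b1.
  have c1 : {for t, continuous (fun t : R => b * Num.sqrt t)}.
    by apply: continuousM; [exact: cst_continuous|exact: sqrt_continuous].
  have c2 : {for t, continuous (fun t : R => - e * t)}.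
    by apply: continuousM; [exact: cst_continuous|exact: cvg_id].
  apply: (@continuousM _ _ (fun t => b * Num.sqrt t) (fun t => rho (b * Num.sqrt t, - e * t))) => //.
  apply: (@continuous_comp _ _ _ (fun t => (b * Num.sqrt t, - e * t)) rho t).
    exact: (cvg_pair c1 c2).
  exact: smooth_at_continuous.
exists (xb 1), (xb (-1)), r, d; split=> //.
- by move=> t tr; split; apply: cxb => //; [left|right].
- by rewrite /xb sqrtr0 !mulr0 !mul0r.
- move=> t /andP[t0 tr]; have tr' : 0 <= t < r by rewrite ltW.
  have st0 : 0 < Num.sqrt t by rewrite sqrtr_gt0.
  have st2 : Num.sqrt t ^+ 2 = t by rewrite sqr_sqrtr // ltW.
  have eqb b : b = 1 \/ b = -1 ->
      a * (- e * t) + xb b t ^+ 2 * m (xb b t, u0 - e * t) = 0.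
    move=> b1; have [_ [_ Em]] := B2 t b tr' b1.
    have b2 : b ^+ 2 = 1 by case: b1 => ->; ring.
    rewrite {1}/xb exprMn exprMn b2 st2 mul1r -mulrA Em.
    by ring.
  split.
  + have [_ [p1 _]] := B2 t 1 tr' (or_introl erefl).
    have [_ [p2 _]] := B2 t (-1) tr' (or_intror erefl).
    by rewrite /xb -!mulrA [X in X < 0]mulN1r oppr_lt0 [X in _ && (_ < X)]mul1r !mulr_gt0.
  + by move=> x [] ->; apply: eqb; [left|right].
  move=> x xd Ex.
  have x0 : x != 0.
    apply: contraPneq Ex => ->; rewrite expr0n /= mul0r addr0.
    apply/eqP; rewrite !mulf_neq0 ?oppr_eq0 ?(gt_eqF t0) //.
    by case: e1 => ->; rewrite ?oppr_eq0 oner_neq0.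
  have [s1 s2] := sq _ tr'.
  have [||M1 M2] := H3 x (u0 - e * t).
  - by rewrite subr0 (lt_le_trans xd).
  - by rewrite addrAC subrr add0r normrN et ?(ltW t0) // (lt_le_trans s2).
  have Mn : m (x, u0 - e * t) != 0 by apply: contraTneq M1 => /= ->; rewrite mulr0 ltxx.
  (* Conversely a zero [x] is [b * sqrt t * z] with [z ^ 2 * m = e * a] and [z]
     close to [rho (0, 0)], so uniqueness of the rescaling identifies [z]. *)
  pose b := Num.sg x; pose z := `|x| / Num.sqrt t.
  have b1 : b = 1 \/ b = -1 by rewrite /b /Num.sg (negPf x0); case: ifP; [right|left].
  have z0 : 0 < z by rewrite divr_gt0 ?normr_gt0.
  have bz : b * Num.sqrt t * z = x.
    by rewrite [RHS]numEsg /z /b; field; rewrite gt_eqF.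
  have z2 : z ^+ 2 * m (x, u0 - e * t) = e * a.
    rewrite /z exprMn exprVn st2 real_normK ?num_real //.
    have -> : x ^+ 2 / t * m (x, u0 - e * t) = (x ^+ 2 * m (x, u0 - e * t)) / t by ring.
    have -> : x ^+ 2 * m (x, u0 - e * t) = e * a * t.
      by apply/eqP; rewrite -subr_eq0 -[X in _ == X]Ex; apply/eqP; ring.
    by rewrite mulfK // gt_eqF.
  have zr : `|z - rho (0, 0)| < d1.
    have := M2; rewrite /= -z2 mulfK // => M3.
    have rz : 0 < rho (0, 0) + z by exact: addr_gt0.
    have : `|z - rho (0, 0)| * (rho (0, 0) + z) < d1 * (rho (0, 0) + z).
      rewrite -{1}(gtr0_norm rz) -normrM.
      have -> : (z - rho (0, 0)) * (rho (0, 0) + z) = - (rho (0, 0) ^+ 2 - z ^+ 2) by ring.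
      rewrite normrN; apply: lt_le_trans M3 _.
      by rewrite ler_pM2l // lerDl ltW.
    by rewrite ltr_pM2r.
  have : z = rho (b * Num.sqrt t, - e * t).
    have Hp : `|(b * Num.sqrt t, - e * t) - (0, 0)| < d1.
      rewrite prod_normE /= !subr0 gt_max; apply/andP; split.
        rewrite normrM (ger0_norm (sqrtr_ge0 t)).
        by case: b1 => ->; rewrite ?normrN normr1 mul1r (lt_le_trans s1).
      by rewrite mulNr normrN et ?(ltW t0) // (lt_le_trans s2).
    by have [+ _] := H1 _ _ Hp zr; apply; rewrite /= bz mulNr.
  move=> zE; have xE : x = xb b t by rewrite /xb -zE bz.
  by case: b1 => b1; rewrite xE b1; [left|right].
- move=> t x tr xd x0; have /andP[t0 _] := tr; have [s1 s2] := sq _ tr.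
  have [||M1 _] := H3 x (u0 + e * t).
  - by rewrite subr0 (lt_le_trans xd).
  - by rewrite addrAC subrr add0r et // (lt_le_trans s2).
  apply/eqP => E.
  have : 0 < a ^+ 2 * t + x ^+ 2 * (e * a * m (x, u0 + e * t)).
    apply: ltr_wpDl; first by rewrite mulr_ge0 ?sqr_ge0.
    by apply: mulr_gt0 => //; rewrite exprn_even_gt0.
  have -> : a ^+ 2 * t + x ^+ 2 * (e * a * m (x, u0 + e * t)) =
      e * a * (a * (e * t) + x ^+ 2 * m (x, u0 + e * t)) + (1 - e * e) * a ^+ 2 * t by ring.
  by rewrite E ee subrr mulr0 !mul0r addr0 ltxx.
Qed.

End CubicNormalForm.

(** * Lyapunov-Schmidt reduction with a cubic nonlinearity *)

Section LyapunovSchmidtGerm.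
Context {R : realType}.

Section Projection.
Context {n : nat} (v : 'cV[R]_n).

Lemma proj_perp_linear : linear (proj_perp v).
Proof.
move=> c x y; rewrite /proj_perp dotvDr dotvZr mulrDl scalerDl opprD addrACA.
by rewrite scalerBr scalerA mulrA.
Qed.

Lemma proj_perpZ c y : proj_perp v (c *: y) = c *: proj_perp v y.
Proof. by rewrite /proj_perp dotvZr scalerBr scalerA mulrA. Qed.

Lemma proj_perpD x y : proj_perp v (x + y) = proj_perp v x + proj_perp v y.
Proof. by rewrite -[x]scale1r proj_perp_linear !scale1r. Qed.

Lemma proj_perp0 : proj_perp v 0 = 0.
Proof. by rewrite /proj_perp dotv0 mul0r scale0r subr0. Qed.

Context (v0 : v != 0).

Let vv : dotv v v != 0. Proof. by rewrite gt_eqF // dotv_gt0. Qed.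

Lemma dotv_proj_perp y : dotv v (proj_perp v y) = 0.
Proof. by rewrite /proj_perp dotvBr dotvZr divfK // subrr. Qed.

Lemma proj_perp_id y : dotv v y = 0 -> proj_perp v y = y.
Proof. by rewrite /proj_perp => ->; rewrite mul0r scale0r subr0. Qed.

Lemma proj_perp_line c : proj_perp v (c *: v) = 0.
Proof. by rewrite /proj_perp dotvZr mulfK // subrr. Qed.

Lemma proj_perpDline c y : proj_perp v (c *: v + y) = proj_perp v y.
Proof. by rewrite proj_perpD proj_perp_line add0r. Qed.

Lemma proj_perp_decomp y : y = (dotv v y / dotv v v) *: v + proj_perp v y.
Proof. by rewrite /proj_perp addrC subrK. Qed.

Lemma proj_perp_line_eq0 c y : proj_perp v y + c *: v = 0 <-> proj_perp v y = 0 /\ c = 0.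
Proof.
split=> [H|[-> ->]]; last by rewrite scale0r addr0.
have c0 : c = 0.
  have := congr1 (dotv v) H; rewrite dotvDr dotv_proj_perp add0r dotvZr dotv0.
  by move/eqP; rewrite mulf_eq0 (negPf vv) orbF => /eqP.
by move: H; rewrite c0 scale0r addr0.
Qed.

End Projection.

Lemma linear_cV_surj n (A : 'cV[R]_n -> 'cV[R]_n) : linear A ->
  (forall w, A w = 0 -> w = 0) -> forall y, exists w, A w = y.
Proof.
move=> lA inj y.
have [M MA] := linear_cV_mx lA.
have uM : M \in unitmx by apply: injective_unitmx => w; rewrite MA => /inj.
by exists (invmx M *m y); rewrite -MA mulKVmx.
Qed.

(** Only the values of [f] on one line matter, where [f] is [h ^ 3] times a
    differentiable function. *)
Lemma derive_cubic (V W : normedModType R) (f : V -> W) (k : R -> W) (w : V) :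
  differentiable f 0 -> differentiable k 0 ->
  (forall h, f (h *: w) = h ^+ 3 *: k h) -> 'D_w f 0 = 0.
Proof.
move=> df dk E; rewrite deriveE //.
have d1 : is_diff (0 : R) (fun h : R => h *: w) (fun h => h *: w) by exact: is_diff_scalel.
have df' : is_diff (0 *: w) f ('d f 0) by rewrite scale0r; exact: differentiableP.
have [_ H] := @is_diff_comp _ _ _ _ (fun h : R => h *: w) _ f _ 0 d1 df'.
have d3 : is_diff (0 : R) (fun h : R => h ^+ 3) (fun y => y * (3%:R * 0 ^+ 2)).
  exact: is_derive_is_diff (is_derive_exp 2 0).
have [d3d d3e] := d3.
have [_ K] := is_diff_scale d3d dk.
transitivity ('d (fun h : R => h ^+ 3 *: k h) 0 1).
  have -> : (fun h : R => h ^+ 3 *: k h) = f \o (fun h : R => h *: w).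
    by apply/funext => h; rewrite /= E.
  by rewrite H /= scale1r.
by rewrite K d3e !expr0n /= !mulr0 !scale0r addr0.
Qed.

Context {n : nat} (B : 'M[R]_n) (N : R -> R -> 'cV[R]_n -> 'cV[R]_n) (d kappa u0 : R) (v : 'cV[R]_n).
Context (v0 : v != 0) (d0 : d != 0) (kappa0 : kappa != 0) (u0E : u0 = d / kappa).
Context (Bsym : B^T = B) (Bv : B *m v = kappa *: v)
  (Bker : forall w, B *m w = kappa *: w -> dotv v w = 0 -> w = 0)
  (Nsm : forall a, smooth_at (fun q : R * R * 'cV[R]_n => N q.1.1 q.1.2 q.2) a)
  (Nhom : forall u x z, N u 1 (x *: z) = x ^+ 3 *: N u x z).

Definition lin_field (u : R) (w : 'cV[R]_n) : 'cV[R]_n := u *: (B *m w) - d *: w.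

Definition cubic_field (y : 'cV[R]_n) (u : R) (b : 'cV[R]_n) : 'cV[R]_n :=
  lin_field u y + N u 1 y + b.

Definition LS_operator (w : 'cV[R]_n) := proj_perp v (lin_field u0 w) + dotv v w *: v.

Let du0 : kappa * u0 = d. Proof. by rewrite u0E mulrC divfK. Qed.

Lemma lin_fieldP u : linear (lin_field u).
Proof.
move=> c x y; rewrite /lin_field mulmxDr -scalemxAr !scalerDr opprD addrACA.
by rewrite !scalerA scalerN scalerA ![c * _]mulrC.
Qed.

Lemma lin_field_eigen u : lin_field u v = (kappa * (u - u0)) *: v.
Proof. by rewrite /lin_field Bv scalerA -scalerBl mulrBr du0 [u * _]mulrC. Qed.

Lemma dotv_lin_field u w : dotv v (lin_field u w) = kappa * (u - u0) * dotv v w.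
Proof.
rewrite /lin_field dotvBr !dotvZr dotv_mulmx Bsym Bv dotvC dotvZr [dotv w v]dotvC.
by rewrite -du0; ring.
Qed.

Lemma LS_operator_linear : linear LS_operator.
Proof.
move=> c x y; rewrite /LS_operator lin_fieldP proj_perp_linear dotvDr dotvZr.
by rewrite scalerDl -scalerA [in RHS]scalerDr addrACA.
Qed.

(** [lin_field u0] is symmetric and vanishes on [v], so it maps into the complement
    of [v]; the added multiple of [v] removes the kernel. *)
Lemma LS_operator_inj w : LS_operator w = 0 -> w = 0.
Proof.
move/proj_perp_line_eq0 => /(_ v0) [+ vw].
rewrite proj_perp_id; last by rewrite dotv_lin_field vw mulr0.
move=> Lw; apply: Bker => //.
have u00 : u0 != 0 by rewrite u0E mulf_neq0 ?invr_eq0.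
apply: (scalerI u00); rewrite scalerA [u0 * _]mulrC du0.
by apply/eqP; rewrite -subr_eq0; apply/eqP.
Qed.

Lemma smooth_lin_field (V : normedModType R) (U : V -> R) (f : V -> 'cV[R]_n) a :
  smooth_at U a -> smooth_at f a -> smooth_at (fun x => lin_field (U x) (f x)) a.
Proof.
move=> sU sf; apply: smooth_at_sub; apply: smooth_at_scale => //; last exact: smooth_at_cst.
by apply: smooth_at_linear_cV => // c x y; rewrite linearP.
Qed.

Lemma smooth_cubic (V : normedModType R) (U X : V -> R) (f : V -> 'cV[R]_n) a :
  smooth_at U a -> smooth_at X a -> smooth_at f a ->
  smooth_at (fun x => N (U x) (X x) (f x)) a.
Proof.
move=> sU sX sf; apply: (smooth_at_comp (f := fun x => (U x, X x, f x))
  (g := fun q : R * R * 'cV[R]_n => N q.1.1 q.1.2 q.2)) => //.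
by do 2!apply: smooth_at_pair => //.
Qed.

Lemma smooth_proj_perp (V : normedModType R) (f : V -> 'cV[R]_n) a :
  smooth_at f a -> smooth_at (fun x => proj_perp v (f x)) a.
Proof. by apply: smooth_at_linear_cV; exact: proj_perp_linear. Qed.

Lemma smooth_dotv (V : normedModType R) (f : V -> 'cV[R]_n) a :
  smooth_at f a -> smooth_at (fun x => dotv v (f x)) a.
Proof. by apply: smooth_at_linear_cV; exact: dotv_linear. Qed.

Lemma smooth_dotv_line (V : normedModType R) (f : V -> 'cV[R]_n) a :
  smooth_at f a -> smooth_at (fun x => dotv v (f x) *: v) a.
Proof. by move=> sf; apply: smooth_at_scale; [exact: smooth_dotv|exact: smooth_at_cst]. Qed.

Lemma smooth_cubic_field (V : normedModType R) (y b : V -> 'cV[R]_n) (u : V -> R) a :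
  smooth_at y a -> smooth_at u a -> smooth_at b a ->
  smooth_at (fun x => cubic_field (y x) (u x) (b x)) a.
Proof.
move=> sy su sb; apply: smooth_at_add => //; apply: smooth_at_add.
  exact: smooth_lin_field.
by apply: smooth_cubic => //; exact: smooth_at_cst.
Qed.

Lemma derive_LS_operator w x : 'D_w LS_operator x = LS_operator w.
Proof.
have [dL L'] := is_diff_linear_cV x LS_operator_linear.
by rewrite deriveE // L'.
Qed.

Lemma lin_field0 u : lin_field u 0 = 0.
Proof. by rewrite /lin_field mulmx0 !scaler0 subrr. Qed.

Lemma lin_fieldZ u c w : lin_field u (c *: w) = c *: lin_field u w.
Proof. by rewrite -[c *: w]addr0 lin_fieldP lin_field0 addr0. Qed.

Lemma cubic0 u : N u 1 0 = 0.
Proof. by rewrite -[X in N u 1 X](scale0r 0) Nhom expr0n /= scale0r. Qed.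

Lemma derive_cubic0 u w : 'D_w (N u 1) 0 = 0.
Proof.
apply: (derive_cubic (k := fun h => N u h w)) => //; apply: smooth_at_differentiable.
  by apply: smooth_cubic; [exact: smooth_at_cst|exact: smooth_at_cst|exact: smooth_at_id].
by apply: smooth_cubic; [exact: smooth_at_cst|exact: smooth_at_id|exact: smooth_at_cst].
Qed.

(** The two orthogonal conditions on [w] are merged into one equation between
    vectors of the same dimension. *)
Definition LS_eqn (z : (R * R * 'cV[R]_n) * 'cV[R]_n) : 'cV[R]_n :=
  proj_perp v (cubic_field (z.1.1.1 *: v + z.2) z.1.1.2 z.1.2) + dotv v z.2 *: v.

Lemma LS_germ : exists W : R * R * 'cV[R]_n -> 'cV[R]_n,
  [/\ smooth_at W (0, u0, 0), W (0, u0, 0) = 0 &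
   \forall z \near ((0, u0, 0) : R * R * 'cV[R]_n, 0 : 'cV[R]_n), LS_eqn z = 0 <-> z.2 = W z.1].
Proof.
have sid := @smooth_at_id R _ (((0, u0, 0) : R * R * 'cV[R]_n), (0 : 'cV[R]_n)).
have s2 := smooth_at_snd sid; have s1 := smooth_at_fst sid.
have s12 := smooth_at_snd s1; have s11 := smooth_at_fst s1.
have s111 := smooth_at_fst s11; have s112 := smooth_at_snd s11.
apply: implicit_cV.
- apply: smooth_at_add; last exact: smooth_dotv_line.
  apply: smooth_proj_perp; apply: smooth_cubic_field => //.
  by apply: smooth_at_add => //; apply: smooth_at_scale => //; exact: smooth_at_cst.
- rewrite /LS_eqn /= /cubic_field scale0r !addr0 dotv0 scale0r addr0 cubic0 addr0.
  by rewrite lin_field0 proj_perp0.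
move=> w.
have -> : (fun w => LS_eqn ((0, u0, 0), w)) =
    LS_operator + (fun w => proj_perp v (N u0 1 w)).
  apply/funext => y; rewrite /LS_eqn /= /cubic_field scale0r add0r addr0 !fctE.
  by rewrite proj_perpD /LS_operator addrAC.
have sN : smooth_at (N u0 1) 0.
  by apply: smooth_cubic; [exact: smooth_at_cst|exact: smooth_at_cst|exact: smooth_at_id].
have sO : smooth_at LS_operator 0.
  exact: (smooth_at_linear_cV (f := fun x => x) LS_operator_linear (smooth_at_id 0)).
rewrite (deriveD (diff_derivable (smooth_at_differentiable sO))
  (diff_derivable (smooth_at_differentiable (smooth_proj_perp sN)))).
rewrite derive_LS_operator [X in _ + X](_ : _ = 0) ?addr0; first exact: LS_operator_inj.
apply: (derive_cubic (k := fun h => proj_perp v (N u0 h w))).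
- by apply: smooth_at_differentiable; exact: smooth_proj_perp.
- apply: smooth_at_differentiable; apply: smooth_proj_perp.
  by apply: smooth_cubic; [exact: smooth_at_cst|exact: smooth_at_id|exact: smooth_at_cst].
- by move=> h; rewrite Nhom proj_perpZ.
Qed.

Lemma LS_eqnP z : LS_eqn z = 0 <->
  proj_perp v (cubic_field (z.1.1.1 *: v + z.2) z.1.1.2 z.1.2) = 0 /\ dotv v z.2 = 0.
Proof. exact: proj_perp_line_eq0. Qed.

Lemma near_graph (V W : normedModType R) (f : V -> W) (a : V) (c : W) (P : V * W -> Prop) :
  smooth_at f a -> f a = c -> (\forall z \near (a, c), P z) -> \forall x \near a, P (x, f x).
Proof.
move=> sf <- HP.
exact: (smooth_at_continuous (smooth_at_pair (smooth_at_id a) sf) HP).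
Qed.

Lemma LS_germ_zero W : smooth_at W (0, u0, 0) -> W (0, u0, 0) = 0 ->
  (\forall z \near ((0, u0, 0) : R * R * 'cV[R]_n, 0 : 'cV[R]_n), LS_eqn z = 0 <-> z.2 = W z.1) ->
  \forall q \near ((0, u0, 0) : R * R * 'cV[R]_n), LS_eqn (q, W q) = 0.
Proof.
move=> sW W0 HW; have := near_graph sW W0 HW.
by apply: filterS => q /= [_]; apply.
Qed.

Lemma LS_solution_exists : exists W, LS_solution cubic_field v u0 W.
Proof.
have [W [sW W0 HW]] := LS_germ; exists W; split=> //.
- exact: smooth_at_smooth_near.
- by apply: filterS (LS_germ_zero sW W0 HW) => q /LS_eqnP[].
apply: filterS HW => z <- vz; rewrite LS_eqnP.
by split=> [|[]].
Qed.

(** Two solutions agree as germs, since each of them satisfies the equation that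
    characterizes the other. *)
Lemma LS_solution_smooth W : LS_solution cubic_field v u0 W -> smooth_at W (0, u0, 0).
Proof.
move=> [_ _ _ HW]; have [W' [sW' W'0 HW']] := LS_germ.
have z1 := LS_germ_zero sW' W'0 HW'.
have z2 := near_graph sW' W'0 HW.
apply: (smooth_at_eq _ sW').
apply: filterS2 z1 z2 => q /LS_eqnP /= [p1 p2] /(_ p2) [+ _].
by apply.
Qed.

(** The orthogonal component of the equilibrium equation at [w = x ^ 3 omega],
    divided by [x ^ 3], merged with the orthogonality to [v].  At [x = 0] it is
    affine in [omega] with the invertible linear part [LS_operator]. *)
Definition scaled_eqn (z : (R * R) * 'cV[R]_n) : 'cV[R]_n :=
  proj_perp v (lin_field z.1.2 z.2 + N z.1.2 z.1.1 (v + z.1.1 ^+ 2 *: z.2)) + dotv v z.2 *: v.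

Lemma scaled_germ : exists omega : R * R -> 'cV[R]_n, smooth_at omega (0, u0) /\
  \forall z \near ((0, u0) : R * R), scaled_eqn (z, omega z) = 0.
Proof.
have [w0 Ew0] := linear_cV_surj LS_operator_linear LS_operator_inj (- proj_perp v (N u0 0 v)).
have sid := @smooth_at_id R _ (((0, u0) : R * R), w0).
have s2 := smooth_at_snd sid; have s1 := smooth_at_fst sid.
have s12 := smooth_at_snd s1; have s11 := smooth_at_fst s1.
have sE : smooth_at scaled_eqn (((0, u0) : R * R), w0).
  apply: smooth_at_add; last exact: smooth_dotv_line.
  apply: smooth_proj_perp; apply: smooth_at_add; first exact: smooth_lin_field.
  apply: smooth_cubic => //; apply: smooth_at_add; first exact: smooth_at_cst.
  by apply: smooth_at_scale => //; exact: smooth_at_exp.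
have EE w : scaled_eqn ((0, u0), w) = LS_operator w + proj_perp v (N u0 0 v).
  rewrite /scaled_eqn /= expr0n /= scale0r addr0 proj_perpD /LS_operator.
  by rewrite addrAC.
have [||| om [som om0 Hom]] := @implicit_cV R n _ scaled_eqn (0, u0) w0.
- exact: sE.
- by rewrite EE Ew0 addNr.
- move=> w; rewrite (_ : (fun w => _) = LS_operator + cst (proj_perp v (N u0 0 v))); last first.
    by apply/funext => y; rewrite EE.
  have sO : smooth_at LS_operator w0.
    exact: (smooth_at_linear_cV (f := fun x => x) LS_operator_linear (smooth_at_id w0)).
  rewrite (deriveD (diff_derivable (smooth_at_differentiable sO)) (derivable_cst _ _ _)).
  by rewrite derive_cst addr0 derive_LS_operator; exact: LS_operator_inj.
exists om; split=> //.
by apply: filterS (near_graph som om0 Hom) => z /= [_]; apply.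
Qed.

Lemma cubic_field_scaled x u w :
  cubic_field (x *: v + x ^+ 3 *: w) u 0 =
  (x * (kappa * (u - u0))) *: v + x ^+ 3 *: (lin_field u w + N u x (v + x ^+ 2 *: w)).
Proof.
have xE : x *: v + x ^+ 3 *: w = x *: (v + x ^+ 2 *: w).
  by rewrite scalerDr scalerA -exprS.
rewrite /cubic_field addr0 {2}xE Nhom lin_fieldP lin_fieldZ lin_field_eigen scalerA.
by rewrite -addrA -scalerDr.
Qed.

Definition reduced_coef (omega : R * R -> 'cV[R]_n) (z : R * R) : R :=
  dotv v (N z.2 z.1 (v + z.1 ^+ 2 *: omega z)).

Lemma reduced_coef_smooth omega : smooth_at omega (0, u0) ->
  smooth_at (reduced_coef omega) (0, u0).
Proof.
move=> som; have sid := @smooth_at_id R _ ((0, u0) : R * R).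
have s2 := smooth_at_snd sid; have s1 := smooth_at_fst sid.
apply: smooth_dotv; apply: smooth_cubic => //; apply: smooth_at_add; first exact: smooth_at_cst.
by apply: smooth_at_scale => //; exact: smooth_at_exp.
Qed.

Lemma reduced_coef0 omega : reduced_coef omega (0, u0) = dotv v (N u0 0 v).
Proof. by rewrite /reduced_coef /= expr0n /= scale0r addr0. Qed.

(** Symmetry of [lin_field u] makes the contribution of [omega] to the linear part
    vanish, for every [u]. *)
Lemma scaled_eqn_reduced omega z : scaled_eqn (z, omega z) = 0 ->
  [/\ dotv v (omega z) = 0,
      proj_perp v (cubic_field (z.1 *: v + z.1 ^+ 3 *: omega z) z.2 0) = 0 &
      dotv v (cubic_field (z.1 *: v + z.1 ^+ 3 *: omega z) z.2 0) =
      z.1 * (kappa * dotv v v * (z.2 - u0) + z.1 ^+ 2 * reduced_coef omega z)].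
Proof.
move=> /proj_perp_line_eq0 => /(_ v0) /= [p1 p2].
rewrite cubic_field_scaled; split=> //.
  by rewrite proj_perpDline // proj_perpZ p1 scaler0.
rewrite dotvDr !dotvZr dotvDr dotv_lin_field p2 /reduced_coef; ring.
Qed.

Lemma LS_solution_scaled W omega : LS_solution cubic_field v u0 W ->
  smooth_at omega (0, u0) ->
  (\forall z \near ((0, u0) : R * R), scaled_eqn (z, omega z) = 0) ->
  \forall z \near ((0, u0) : R * R), W (z.1, z.2, 0) = z.1 ^+ 3 *: omega z.
Proof.
move=> [_ _ _ HW] som Hom; have sid := @smooth_at_id R _ ((0, u0) : R * R).
have s2 := smooth_at_snd sid; have s1 := smooth_at_fst sid.
have c : smooth_at (fun z : R * R => ((z.1, z.2, 0 : 'cV[R]_n), z.1 ^+ 3 *: omega z)) (0, u0).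
  apply: smooth_at_pair.
    by apply: smooth_at_pair; [exact: smooth_at_pair|exact: smooth_at_cst].
  by apply: smooth_at_scale => //; exact: smooth_at_exp.
have c0 : (((0 : R, u0).1, (0 : R, u0).2, 0 : 'cV[R]_n), (0 : R, u0).1 ^+ 3 *: omega (0, u0)) =
    ((0 : R, u0, 0 : 'cV[R]_n), 0 : 'cV[R]_n) by rewrite /= expr0n /= scale0r.
rewrite -c0 in HW.
have HW' : \forall z \near ((0, u0) : R * R), dotv v (z.1 ^+ 3 *: omega z) = 0 ->
    (proj_perp v (cubic_field (z.1 *: v + z.1 ^+ 3 *: omega z) z.2 0) = 0 <->
    z.1 ^+ 3 *: omega z = W (z.1, z.2, 0)) by exact: (smooth_at_continuous c HW).
apply: filterS2 Hom HW' => z /scaled_eqn_reduced[p1 p2 _].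
by rewrite dotvZr p1 mulr0 => /(_ erefl) [/(_ p2)].
Qed.

Lemma LS_reduction_cubic W omega : LS_solution cubic_field v u0 W ->
  smooth_at omega (0, u0) ->
  (\forall z \near ((0, u0) : R * R), scaled_eqn (z, omega z) = 0) ->
  \forall z \near ((0, u0) : R * R), LS_reduction cubic_field v W z.1 z.2 0 =
     z.1 * (kappa * dotv v v * (z.2 - u0) + z.1 ^+ 2 * reduced_coef omega z).
Proof.
move=> HW som Hom; apply: filterS2 Hom (LS_solution_scaled HW som Hom) => z.
by move=> /scaled_eqn_reduced[_ _ <-] Wz; rewrite /LS_reduction Wz.
Qed.

Lemma LS_reduction_unfolding W : LS_solution cubic_field v u0 W ->
  is_unfolding (fun x u => LS_reduction cubic_field v W x u 0) 0 u0
    (LS_reduction cubic_field v W).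
Proof.
move=> HW; split; last by exists (setT, setT) => [|z _ //]; split; exact: filterT.
apply: smooth_at_smooth_near; have sW := LS_solution_smooth HW.
have sid := @smooth_at_id R _ ((0, u0, 0) : R * R * 'cV[R]_n).
have s2 := smooth_at_snd sid; have s1 := smooth_at_fst sid.
have s12 := smooth_at_snd s1; have s11 := smooth_at_fst s1.
apply: smooth_dotv; apply: smooth_cubic_field => //.
apply: smooth_at_add; first by apply: smooth_at_scale => //; exact: smooth_at_cst.
apply: smooth_at_eq sW; exists (setT, setT) => [|[[x u] b] _ //].
by split; exact: filterT.
Qed.

(** Along [x = 0] and [u = u0] the reduction is [dotv v b] plus the cubic term at
    [W], whose differential at [0] is zero. *)
Lemma LS_reduction_derive_bias W i : LS_solution cubic_field v u0 W ->
  is_derive (0 : 'cV[R]_n) (delta_mx i 0 : 'cV[R]_n) (LS_reduction cubic_field v W 0 u0) (v i 0).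
Proof.
move=> HW; have sW := LS_solution_smooth HW.
have [_ W0 Wv _] := HW.
have sb : smooth_at (fun b : 'cV[R]_n => W (0, u0, b)) 0.
  apply: (smooth_at_comp (f := fun b : 'cV[R]_n => (0, u0, b) : R * R * 'cV[R]_n)) => //.
  by apply: smooth_at_pair; [exact: smooth_at_cst|exact: smooth_at_id].
have sN : smooth_at (N u0 1) 0.
  by apply: smooth_cubic; [exact: smooth_at_cst|exact: smooth_at_cst|exact: smooth_at_id].
have n1 : \forall b \near (0 : 'cV[R]_n), dotv v (W (0, u0, b)) = 0.
  have c : smooth_at (fun b : 'cV[R]_n => (0, u0, b) : R * R * 'cV[R]_n) 0.
    by apply: smooth_at_pair; [exact: smooth_at_cst|exact: smooth_at_id].
  exact: (smooth_at_continuous c Wv).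
have dN : is_diff (W (0, u0, 0)) (N u0 1) ('d (N u0 1) 0).
  by rewrite W0; apply: differentiableP; exact: smooth_at_differentiable.
have dW := differentiableP (smooth_at_differentiable sb).
have dNW := @is_diff_comp _ _ _ _ _ _ _ _ _ dW dN.
have dv x := is_diff_linear_cV x (dotv_linear v).
have d1 := @is_diff_comp _ _ _ _ _ _ _ _ _ dNW (dv _).
have d2 := is_diffD d1 (dv 0).
have D : is_derive (0 : 'cV[R]_n) (delta_mx i 0 : 'cV[R]_n)
    (fun b => dotv v (N u0 1 (W (0, u0, b))) + dotv v b) (dotv v (delta_mx i 0)).
  case: d2 => d3 d4; apply: DeriveDef; first exact: diff_derivable.
  rewrite deriveE // [LHS](congr1 (fun f => f _) d4) !fctE /=.
  rewrite -[X in dotv v X + _]deriveE; last exact: smooth_at_differentiable.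
  by rewrite derive_cubic0 dotv0 add0r.
have -> : v i 0 = dotv v (delta_mx i 0).
  rewrite /dotv (bigD1 i) //= big1 ?addr0 => [|j ji]; first by rewrite mxE !eqxx mulr1.
  by rewrite mxE (negPf ji) mulr0.
apply: near_eq_is_derive D; move: n1; apply: filterS => b Wb.
rewrite /LS_reduction /cubic_field scale0r add0r [in RHS]dotvDr [dotv v (lin_field _ _ + _)]dotvDr.
by rewrite dotv_lin_field Wb mulr0 add0r.
Qed.

Lemma cubic_field_eq0 y u b :
  cubic_field y u b = 0 <->
  proj_perp v (cubic_field y u b) = 0 /\ dotv v (cubic_field y u b) = 0.
Proof.
split=> [->|[p1 p2]]; first by rewrite proj_perp0 dotv0.
by rewrite [LHS](proj_perp_decomp v) p1 p2 mul0r scale0r addr0.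
Qed.

(** Near the origin the equilibria are described by the reduced scalar equation
    together with the graph of [x ^ 3 * omega]. *)
Lemma LS_local_zeros omega : smooth_at omega (0, u0) ->
  (\forall z \near ((0, u0) : R * R), scaled_eqn (z, omega z) = 0) ->
  exists2 D : R, 0 < D & forall x u w, `|x| < D -> `|u - u0| < D -> `|w| < D -> dotv v w = 0 ->
    (cubic_field (x *: v + w) u 0 = 0 <-> w = x ^+ 3 *: omega (x, u) /\
      (x = 0 \/ kappa * dotv v v * (u - u0) + x ^+ 2 * reduced_coef omega (x, u) = 0)).
Proof.
move=> som Hom; have [W HW] := LS_solution_exists.
have n1 := LS_solution_scaled HW som Hom; have [_ _ _ n2] := HW.
have sid := @smooth_at_id R _ (((0, u0) : R * R), (0 : 'cV[R]_n)).
have s2 := smooth_at_snd sid; have s1 := smooth_at_fst sid.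
have c2 : smooth_at (fun z : (R * R) * 'cV[R]_n => (z.1.1, z.1.2, 0 : 'cV[R]_n, z.2)) ((0, u0), 0).
  apply: smooth_at_pair => //; apply: smooth_at_pair; last exact: smooth_at_cst.
  by apply: smooth_at_pair; [exact: smooth_at_fst|exact: smooth_at_snd].
have n1' : \forall z \near ((0 : R, u0), 0 : 'cV[R]_n),
    W (z.1.1, z.1.2, 0) = z.1.1 ^+ 3 *: omega z.1 by exact: (smooth_at_continuous s1 n1).
have n3' : \forall z \near ((0 : R, u0), 0 : 'cV[R]_n), scaled_eqn (z.1, omega z.1) = 0.
  exact: (smooth_at_continuous s1 Hom).
have n2' : \forall z \near ((0 : R, u0), 0 : 'cV[R]_n), dotv v z.2 = 0 ->
    (proj_perp v (cubic_field (z.1.1 *: v + z.2) z.1.2 0) = 0 <-> z.2 = W (z.1.1, z.1.2, 0)).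
  exact: (smooth_at_continuous c2 n2).
have [D D0 HD] := near_prod_bound (filterI n2' (filterI n1' n3')).
exists D => // x u w xD uD wD vw.
have [||H2 [H1 H3]] := HD (x, u) w; rewrite /= ?subr0 //.
  by rewrite prod_normE /= subr0 gt_max xD uD.
have [/= p1 p2 p3] := scaled_eqn_reduced H3.
rewrite /= in H1 H2; rewrite cubic_field_eq0 H2 // H1; split.
  move=> [wE]; rewrite wE p3 => /eqP; rewrite mulf_eq0 => /orP[]/eqP H.
    by split=> //; left.
  by split=> //; right.
move=> [wE xu]; split=> //; rewrite wE p3.
by case: xu => ->; rewrite ?mul0r ?mulr0.
Qed.

(** On a nontrivial branch [u] is the function [U] of [x], so the equilibria for
    all parameters lie on the single curve [x *: v + x ^ 3 *: omega (x, U x)]. *)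
Lemma LS_pitchfork_branches (e : R) : e = 1 \/ e = -1 ->
  0 < e * (kappa * dotv v v) * dotv v (N u0 0 v) ->
  pitchfork_branches (fun y u => cubic_field y u 0) v u0 (- e).
Proof.
move=> e1 eaC; have [om [som Hom]] := scaled_germ.
pose a := kappa * dotv v v; pose m := reduced_coef om.
have a0 : a != 0 by rewrite mulf_neq0 // gt_eqF // dotv_gt0.
have sm : smooth_at m (0, u0) by exact: reduced_coef_smooth.
have eam : 0 < e * a * m (0, u0) by rewrite /m reduced_coef0.
have [U [sU U0 HU]] := cubic_parameter sm a0.
have [xp [xm [r1 [d1 [[r10 d10] cx [xp0 xm0] Hb Hn]]]]] := cubic_branches sm a0 e1 eam.
have [d2 d20 Hz] := LS_local_zeros som Hom.
have [d3 d30 H3] := near_prod_bound (filterI Hom HU).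
pose D := Num.min d1 (Num.min d2 d3).
have D0 : 0 < D by rewrite !lt_min d10 d20 d30.
have [Dd1 Dd2 Dd3] : [/\ D <= d1, D <= d2 & D <= d3] by rewrite /D !ge_min !lexx !orbT.
clearbody D.
pose k x := proj_perp v (om (x, U x)).
(* The projection changes nothing near [0], but makes [w x] orthogonal to [v] for
   every [x]. *)
pose w x := proj_perp v (x ^+ 3 *: om (x, U x)).
have somU : smooth_at (fun x => om (x, U x)) 0.
  apply: (smooth_at_comp (f := fun x : R => (x, U x))); last by rewrite U0.
  by apply: smooth_at_pair => //; exact: smooth_at_id.
have sw : smooth_at w 0.
  apply: smooth_proj_perp; apply: smooth_at_scale => //.
  by apply: smooth_at_exp; exact: smooth_at_id.
have w0 : w 0 = 0 by rewrite /w expr0n /= scale0r proj_perp0.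
have vw x : dotv v (w x) = 0 by exact: dotv_proj_perp.
pose c x := x *: v + w x.
have cx1 x : dotv v (c x) / dotv v v = x.
  by rewrite /c dotvDr vw addr0 dotvZr mulfK // gt_eqF // dotv_gt0.
have cx2 x : proj_perp v (c x) = w x by rewrite /c proj_perpDline // proj_perp_id.
pose Ng := [set y : 'cV[R]_n | `|dotv v y / dotv v v| < D /\ `|proj_perp v y| < D].
have N0 : nbhs (0 : 'cV[R]_n) Ng.
  have sx : smooth_at (fun y : 'cV[R]_n => dotv v y / dotv v v) 0.
    by apply: smooth_at_mul; [exact: smooth_dotv (smooth_at_id _)|exact: smooth_at_cst].
  have sy : smooth_at (proj_perp v) 0 by exact: smooth_proj_perp (smooth_at_id _).
  have := smooth_at_continuous sx => /cvgrPdist_lt /(_ D D0) h1.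
  have := smooth_at_continuous sy => /cvgrPdist_lt /(_ D D0) h2.
  apply: filterS2 h1 h2 => y; rewrite dotv0 mul0r proj_perp0 !sub0r !normrN.
  by split.
have [D' D'0 Hw] : exists2 D' : R, 0 < D' & forall x, `|x| < D' -> `|x| < D /\ `|w x| < D.
  have := smooth_at_continuous sw => /cvgrPdist_lt /(_ D D0).
  move=> /nbhs_ballP[dl /= dl0 Hdl]; exists (Num.min dl D); first by rewrite lt_min dl0.
  move=> x; rewrite lt_min => /andP[xd xD]; split=> //.
  have := Hdl x; rewrite -ball_normE /= sub0r normrN w0 sub0r normrN; exact.
have [r2 r20 Hr2] : exists2 r2 : R, 0 < r2 &
    forall t, `|t| < r2 -> `|xp t| < D' /\ `|xm t| < D'.
  have [c1 c2] : {for 0, continuous xp} /\ {for 0, continuous xm} by apply: cx; rewrite lexx.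
  have h1 : \forall t \near (0 : R), `|xp t| < D'.
    have := c1 => /cvgrPdist_lt /(_ D' D'0); apply: filterS => t.
    by rewrite xp0 sub0r normrN.
  have h2 : \forall t \near (0 : R), `|xm t| < D'.
    have := c2 => /cvgrPdist_lt /(_ D' D'0); apply: filterS => t.
    by rewrite xm0 sub0r normrN.
  have : \forall t \near (0 : R), `|xp t| < D' /\ `|xm t| < D' by exact: filterI.
  move=> /nbhs_ballP[r2 /= r20 Hr2]; exists r2 => // t tr.
  by apply: Hr2; rewrite -ball_normE /= sub0r normrN.
pose r := Num.min r1 (Num.min r2 D).
have r0 : 0 < r by rewrite !lt_min r10 r20 D0.
have rP t : 0 <= t < r -> [/\ 0 <= t < r1, `|t| < r2 & `|e * t| < D].
  move=> /andP[t0]; rewrite !lt_min => /and3P[tr1 tr2 tD]; rewrite t0 tr1 normrM (ger0_norm t0).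
  by split=> //; case: e1 => ->; rewrite ?normrN normr1 mul1r.
have F0 u : cubic_field 0 u 0 = 0 by rewrite /cubic_field lin_field0 cubic0 !addr0.
have Ng0 : Ng 0 by exact: nbhs_singleton N0.
have zeros y u : Ng y -> `|u - u0| < D -> cubic_field y u 0 = 0 ->
    let x := dotv v y / dotv v v in y = c x /\
    (x = 0 \/ (a * (u - u0) + x ^+ 2 * m (x, u) = 0)).
  move=> [xD wD] uD Fy x; have yE := proj_perp_decomp v y.
  have [|||h1 _] := Hz x u (proj_perp v y) _ _ _ (dotv_proj_perp v0 y);
    try exact: lt_le_trans Dd2.
  rewrite -yE in h1; have [wE xu] := h1 Fy; split=> //.
  rewrite {1}yE /c; congr (_ + _); case: xu => [x0|xu].
    by rewrite wE -/x x0 w0 expr0n /= scale0r.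
  have [||_ [/(_ xu) /= uU _]] := H3 x u; rewrite ?subr0; try exact: lt_le_trans Dd3.
  by rewrite /w -uU -wE [RHS]proj_perp_id // dotv_proj_perp.
exists w, xp, xm, Ng, r; split=> //.
- split=> //; first exact: smooth_at_smooth_near.
  rewrite derive1E; apply: (derive_cubic (k := k)).
  + exact: smooth_at_differentiable.
  + by apply: smooth_at_differentiable; exact: smooth_proj_perp.
  + by move=> h; rewrite /w /k [h *: 1]mulr1 proj_perpZ.
- have [c1 c2] : {for 0, continuous xp} /\ {for 0, continuous xm} by apply: cx; rewrite lexx.
  split.
  + move=> t /andP[t0 tr]; apply: cx.
    by have [] := rP t; rewrite ?(ltW t0).
  + by apply: cvg_at_right_filter; rewrite -[X in _ --> X]xp0; exact: c1.
  + by apply: cvg_at_right_filter; rewrite -[X in _ --> X]xm0; exact: c2.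
- move=> t /andP[t0 tr].
  have [tr1 tr2 tD] : [/\ 0 <= t < r1, `|t| < r2 & `|e * t| < D] by apply: rP; rewrite (ltW t0).
  have [|pm eqs uniq] := Hb t; first by rewrite t0; case/andP: tr1.
  split=> //.
  have uE : u0 + - e * t = u0 - e * t by rewrite mulNr.
  have uD : `|u0 - e * t - u0| < D by rewrite addrAC subrr add0r normrN.
  have du : u0 - e * t - u0 = - e * t by rewrite mulNr; ring.
  have zero x : x = xp t \/ x = xm t -> Ng (c x) /\ cubic_field (c x) (u0 - e * t) 0 = 0.
    move=> xE; have xD' : `|x| < D'.
      by have [h1 h2] := Hr2 t tr2; case: xE => ->.
    have [xD wxD] := Hw x xD'; split; first by split; rewrite ?cx1 ?cx2.
    have eqx : a * (u0 - e * t - u0) + x ^+ 2 * m (x, u0 - e * t) = 0.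
      by rewrite du; exact: eqs.
    have [||h1 [/= /(_ eqx) uU _]] := H3 x (u0 - e * t);
      rewrite ?subr0; try exact: lt_le_trans Dd3.
    have [/= h2 h3 h4] := scaled_eqn_reduced h1.
    have wE : w x = x ^+ 3 *: om (x, u0 - e * t).
      by rewrite /w -uU proj_perp_id // dotvZr h2 mulr0.
    by rewrite /c wE cubic_field_eq0 h3 h4 -/a -/m eqx mulr0.
  rewrite uE; apply/seteqP; split=> [y /= [Ny Fy]|y /= [[->|->]|->]].
  + have [yE [x0|xu]] := zeros _ _ Ny uD Fy.
      by left; left; rewrite yE x0 /c scale0r w0 addr0.
    rewrite du in xu; have [xE|xE] := uniq _ (lt_le_trans Ny.1 Dd1) xu.
      by left; right; rewrite yE xE.
    by right; rewrite yE xE.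
  + by split.
  + by apply: zero; left.
  + by apply: zero; right.
- move=> t tr; have [tr1 tr2 tD] := rP t tr.
  have uE : u0 - - e * t = u0 + e * t by rewrite mulNr opprK.
  have uD : `|u0 + e * t - u0| < D by rewrite addrAC subrr add0r.
  rewrite uE; apply/seteqP; split=> [y /= [Ny Fy]|y /= ->]; last by split.
  have [yE [x0|xu]] := zeros _ _ Ny uD Fy; first by rewrite yE x0 /c scale0r w0 addr0.
  have [x0|x0] := eqVneq (dotv v y / dotv v v) 0.
    by rewrite yE x0 /c scale0r w0 addr0.
  have := Hn t _ tr1 (lt_le_trans Ny.1 Dd1) x0.
  have du : u0 + e * t - u0 = e * t by ring.
  by rewrite du in xu; rewrite xu eqxx.
Qed.

End LyapunovSchmidtGerm.

(** * The vector field as a linear part plus a cubic part *)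

Section Model.
Context {R : realType} {Na No : nat}.
Context (p : 'I_Na -> 'cV[R]_No) (Aa : 'M[R]_Na) (alpha gamma : R).

Lemma dotv_unitv n (x : 'cV[R]_n) : x != 0 -> dotv (unitv x) (unitv x) = 1.
Proof.
move=> x0; have xx := dotv_gt0 x0.
rewrite /unitv dotvZr dotvC dotvZr mulrA -invfM -expr2 sqr_sqrtr ?ltW //.
by rewrite mulVf // gt_eqF.
Qed.

Lemma transformed_adj_sym : Aa^T = Aa -> (transformed_adj p Aa)^T = transformed_adj p Aa.
Proof.
move=> As; apply/matrixP => i k; rewrite !mxE dotvC; congr (_ * _).
by rewrite -{1}As mxE.
Qed.

Lemma net_input_linear i : linear (fun y => net_input p Aa alpha gamma y i).
Proof.
move=> c x y; rewrite /net_input [in RHS]scalerDr addrACA; congr (_ + _).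
  by rewrite !mxE mulrDr scalerDl scalerA mulrCA.
rewrite scalerA [c * gamma]mulrC -scalerA -scalerDr; congr (_ *: _).
rewrite scaler_sumr -big_split; apply: eq_bigr => k _ /=.
by rewrite !mxE mulrDr scalerDl scalerA mulrCA.
Qed.

(** The matrix whose product with [u] is the Jacobian at the origin, up to the
    damping. *)
Definition growth_mx : 'M[R]_Na := alpha%:M + gamma *: transformed_adj p Aa.

Lemma dotv_net_input y i : (forall i, p i != 0) -> (forall i, Aa i i = 0) ->
  dotv (unitv (p i)) (net_input p Aa alpha gamma y i) = (growth_mx *m y) i 0.
Proof.
move=> hp hA0; rewrite /net_input dotvDr [dotv _ ((alpha * _) *: _)]dotvZr [dotv _ (gamma *: _)]dotvZr.
rewrite dotv_unitv // mulr1.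
rewrite /growth_mx mulmxDl mul_scalar_mx -scalemxAl !mxE; congr (_ + _ * _).
rewrite [RHS](bigD1 i) //= mxE hA0 mulr0 mul0r add0r.
transitivity (\sum_(k | k != i) dotv (unitv (p i)) ((Aa i k * y k 0) *: unitv (p k))).
  rewrite /dotv exchange_big; apply: eq_bigr => j _.
  by rewrite summxE mulr_sumr.
by apply: eq_bigr => k _; rewrite [LHS]dotvZr mxE; ring.
Qed.

(** At [x = 1] this is the part of the saturated input beyond its linear term; the
    factor [x] inside [r] records a rescaling of the state. *)
Definition saturation_cubic (r : R -> R) (u x : R) (z : 'cV[R]_Na) : 'cV[R]_Na :=
  \col_i \sum_j unitv (p i) j 0 * ((u * net_input p Aa alpha gamma z i j 0) ^+ 3 *
    r (x * (u * net_input p Aa alpha gamma z i j 0))).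

Lemma net_inputZ c y i j :
  net_input p Aa alpha gamma (c *: y) i j 0 = c * net_input p Aa alpha gamma y i j 0.
Proof.
have lin := net_input_linear i.
have z0 : net_input p Aa alpha gamma 0 i = 0.
  by have := lin (-1) 0 0; rewrite scaleN1r oppr0 addr0 scaleN1r addNr.
by have := lin c y 0; rewrite addr0 z0 addr0 => ->; rewrite mxE.
Qed.

Lemma saturation_cubic_hom r u x z :
  saturation_cubic r u 1 (x *: z) = x ^+ 3 *: saturation_cubic r u x z.
Proof.
apply/colP => i; rewrite !mxE mulr_sumr; apply: eq_bigr => j _.
rewrite net_inputZ mul1r [u * (x * _)]mulrCA.
by move: (r _) => q; ring.
Qed.

Lemma saturation_cubic_smooth r a : (forall k, frechet_C k r setT) ->
  smooth_at (fun q : R * R * 'cV[R]_Na => saturation_cubic r q.1.1 q.1.2 q.2) a.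
Proof.
move=> sr; have sid := smooth_at_id a.
have s2 := smooth_at_snd sid; have s1 := smooth_at_fst sid.
have s12 := smooth_at_snd s1; have s11 := smooth_at_fst s1.
apply: smooth_at_cV => i.
apply: (@smooth_at_ext R _ R (fun q : R * R * 'cV[R]_Na =>
  \sum_j unitv (p i) j 0 * ((q.1.1 * net_input p Aa alpha gamma q.2 i j 0) ^+ 3 *
    r (q.1.2 * (q.1.1 * net_input p Aa alpha gamma q.2 i j 0))))).
  by move=> q; rewrite mxE.
apply: smooth_at_sum => j _; apply: smooth_at_mul; first exact: smooth_at_cst.
have sn : smooth_at (fun q : R * R * 'cV[R]_Na => q.1.1 * net_input p Aa alpha gamma q.2 i j 0) a.
  apply: smooth_at_mul => //; apply: smooth_at_coord.
  by apply: (smooth_at_linear_cV (L := fun y => net_input p Aa alpha gamma y i)) => //;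
    exact: net_input_linear.
apply: smooth_at_mul; first exact: smooth_at_exp.
apply: (smooth_at_comp (g := r)); first exact: smooth_at_mul.
exact: frechet_C_smooth_at.
Qed.

Lemma dotv_saturation_cubic0 r u v :
  dotv v (saturation_cubic r u 0 v) = u ^+ 3 * r 0 * cubic_coef p Aa alpha gamma v.
Proof.
rewrite /cubic_coef mulr_sumr; apply: eq_bigr => i _.
rewrite mxE /dotv !mulr_sumr.
apply: eq_bigr => j _; rewrite mul0r [map_mx _ _ _ _]mxE; move: (r 0) => q; ring.
Qed.

Lemma vfield_cubic S r d : (forall i, p i != 0) -> (forall i, Aa i i = 0) ->
  (forall z, S z = z + z ^+ 3 * r z) ->
  vfield p Aa S d alpha gamma = cubic_field growth_mx (saturation_cubic r) d.
Proof.
move=> hp hA0 SE; apply/funext => y; apply/funext => u; apply/funext => b.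
apply/colP => i.
have -> : cubic_field growth_mx (saturation_cubic r) d y u b i 0 =
    u * (growth_mx *m y) i 0 - d * y i 0 + saturation_cubic r u 1 y i 0 + b i 0.
  by rewrite !mxE.
rewrite [LHS]mxE; congr (_ + _).
have -> : dotv (unitv (p i)) (map_mx S (u *: net_input p Aa alpha gamma y i)) =
    u * (growth_mx *m y) i 0 + saturation_cubic r u 1 y i 0.
  rewrite -(dotv_net_input y i hp hA0) mulr_sumr [saturation_cubic _ _ _ _ _ _]mxE.
  rewrite -big_split /=; apply: eq_bigr => j _.
  have uE : (u *: net_input p Aa alpha gamma y i) j 0 = u * net_input p Aa alpha gamma y i j 0.
    by rewrite mxE.
  rewrite [map_mx _ _ _ _]mxE uE SE mul1r.
  by move: (unitv (p i) j 0) (r _) => w q; ring.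
by ring.
Qed.

End Model.

(** * The pitchfork theorem *)

Theorem mainTheorem3 (R : realType) (Na No : nat)
    (p : 'I_Na -> 'cV[R]_No) (Aa : 'M[R]_Na) (S : R -> R)
    (d alpha gamma lambda ustar : R) (v : 'cV[R]_Na)
    (hp : forall i, p i != 0)
    (hAsym : Aa^T = Aa)
    (hA01 : forall i k, Aa i k = 0 \/ Aa i k = 1)
    (hA0 : forall i, Aa i i = 0)
    (hAirr : irreducible_mx Aa)
    (hS : sigmoid S)
    (hd : 0 < d) (halpha : 0 < alpha) (hgamma : 0 < gamma)
    (hlambda : mup lambda (char_poly (transformed_adj p Aa)) = 1%N)
    (hv0 : v != 0)
    (hv : transformed_adj p Aa *m v = lambda *: v)
    (hne : alpha + lambda * gamma != 0)
    (hustar : ustar = d / (alpha + lambda * gamma))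
    (* nondegeneracy of the cubic term *)
    (hS3 : S^`(3)%classic 0 != 0)
    (hC : cubic_coef p Aa alpha gamma v != 0) :
  let Phi := vfield p Aa S d alpha gamma in
  let C := cubic_coef p Aa alpha gamma v in
  (exists W, LS_solution Phi v ustar W) /\
  forall W, LS_solution Phi v ustar W ->
    let h := LS_reduction Phi v W in
    let h0 := fun x u => h x u 0 in
    let Phi0 := fun y u => Phi y u 0 in
    [/\ symmetric_pitchfork h0 0 ustar,
        0 < C ->
          [/\ pitchfork_branches Phi0 v ustar 1,
              0 < ustar -> supercritical h0 ustar
            & ustar < 0 -> subcritical h0 ustar],
        C < 0 -> pitchfork_branches Phi0 v ustar (-1)
      & is_unfolding h0 0 ustar h /\
        forall i, is_derive (0 : 'cV[R]_Na) (delta_mx i 0 : 'cV[R]_Na)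
                    (h 0 ustar) (v i 0)].
Proof.
move=> Phi C.
have [r [smr SE r0]] := sigmoid_cubic hS hS3.
pose B := growth_mx p Aa alpha gamma; pose N := saturation_cubic p Aa alpha gamma r.
pose kappa := alpha + lambda * gamma.
have PhiE : Phi = cubic_field B N d by exact: vfield_cubic.
have d0 : d != 0 by rewrite gt_eqF.
have Asym := transformed_adj_sym p hAsym.
have Bsym : B^T = B by rewrite /B /growth_mx linearD linearZ /= tr_scalar_mx Asym.
have Bw w : B *m w = alpha *: w + gamma *: (transformed_adj p Aa *m w).
  by rewrite /B /growth_mx mulmxDl mul_scalar_mx scalemxAl.
have Bv : B *m v = kappa *: v by rewrite Bw hv scalerA -scalerDl [gamma * _]mulrC.
have Bker w : B *m w = kappa *: w -> dotv v w = 0 -> w = 0.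
  move=> Bww; apply: (simple_eigenvector Asym hlambda hv0 hv).
  have g0 : gamma != 0 by rewrite gt_eqF.
  apply: (scalerI g0); move: Bww; rewrite Bw /kappa scalerDl => /addrI ->.
  by rewrite scalerA mulrC.
have Nsm a : smooth_at (fun q : R * R * 'cV[R]_Na => N q.1.1 q.1.2 q.2) a.
  exact: saturation_cubic_smooth.
have Nhom u x z : N u 1 (x *: z) = x ^+ 3 *: N u x z by exact: saturation_cubic_hom.
have NC : dotv v (N ustar 0 v) = ustar ^+ 3 * r 0 * C by exact: dotv_saturation_cubic0.
have vv : 0 < dotv v v by exact: dotv_gt0.
have ku : kappa * ustar ^+ 3 = d ^+ 3 / kappa ^+ 2 by rewrite hustar -/kappa; field.
have ku0 : 0 < kappa * ustar ^+ 3.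
  have k2 : 0 < kappa ^+ 2 by rewrite exprn_even_gt0.
  by rewrite ku divr_gt0 // exprn_gt0.
have us0 : ustar != 0 by rewrite hustar mulf_neq0 ?invr_eq0.
(* [kappa] and [ustar] have the same sign, so the branches go to the side given by
   the sign of [C] alone. *)
have br (e : R) : e = 1 \/ e = -1 -> 0 < - e * C -> pitchfork_branches (fun y u => Phi y u 0) v ustar (- e).
  move=> e1 eC; rewrite PhiE.
  apply: (LS_pitchfork_branches hv0 d0 hne hustar Bsym Bv Bker Nsm Nhom e1).
  have -> : e * (kappa * dotv v v) * dotv v (N ustar 0 v) =
     (kappa * ustar ^+ 3) * dotv v v * (- r 0) * (- e * C) by rewrite NC; ring.
  apply: mulr_gt0 => //; apply: mulr_gt0; last by rewrite oppr_gt0.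
  exact: mulr_gt0.
split.
  by rewrite PhiE; exact: (LS_solution_exists hv0 d0 hne hustar Bsym Bv Bker Nsm Nhom).
rewrite PhiE => W HW h h0 Phi0.
have [om [som Hom]] := scaled_germ hv0 d0 hne hustar Bsym Bv Bker Nsm.
have redE := LS_reduction_cubic hv0 hne hustar Bsym Bv Nhom HW som Hom.
pose m := reduced_coef N v om.
have sm : smooth_at m (0, ustar) by exact: reduced_coef_smooth.
have mE : m (0, ustar) = ustar ^+ 3 * r 0 * C by rewrite /m reduced_coef0.
have a0 : kappa * dotv v v != 0 by rewrite mulf_neq0 // gt_eqF.
have m0 : m (0, ustar) != 0 by rewrite mE !mulf_neq0 ?expf_neq0 // lt_eqF.
pose e := Num.sg (kappa * dotv v v * m (0, ustar)).
have e1 : e = 1 \/ e = -1.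
  by rewrite /e /Num.sg mulf_eq0 (negPf a0) (negPf m0) /=; case: ifP; [right|left].
have em : 0 < e * (kappa * dotv v v) * m (0, ustar).
  by rewrite -mulrA -normrEsg normr_gt0 mulf_neq0.
have stab := cubic_stability (g := h0) sm m0 redE.
split.
- exact: (cubic_normal_form (g := h0) sm a0 e1 em redE).
- move=> C0; split.
  + rewrite -[X in pitchfork_branches _ _ _ X]opprK /Phi0 -PhiE.
    by apply: br; [right|rewrite opprK mul1r].
  + move=> u0; have mn : m (0, ustar) < 0.
      by rewrite mE -mulrA pmulr_rlt0 ?exprn_gt0 // nmulr_rlt0.
    apply: filterS stab => z H zn gz; have [h1 h2] := H zn gz.
    by move: h1 h2; rewrite nmulr_lgt0 // nmulr_llt0.
  + move=> u0; have mp : 0 < m (0, ustar).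
      by rewrite mE -mulrA nmulr_rgt0 ?exprn_odd_lt0 // nmulr_rlt0.
    apply: filterS stab => z H zn gz; have [h1 h2] := H zn gz.
    by move: h1 h2; rewrite pmulr_lgt0 // pmulr_llt0.
- move=> Cn; rewrite /Phi0 -PhiE; apply: br; first by left.
  by rewrite mulN1r oppr_gt0.
- split; first exact: (LS_reduction_unfolding hv0 d0 hne hustar Bsym Bv Bker Nsm Nhom HW).
  move=> i.
  exact: (LS_reduction_derive_bias hv0 d0 hne hustar Bsym Bv Bker Nsm Nhom i HW).
Qed.
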